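(* Let $R>0$, let $(v_N)_{N\ge1}$ be a sequence of unit vectors $v_N\in\mathbb{C}^N$ and, for each $N$, let $U_N$ be a uniform random unitary $N\times N$ matrix leaving $v_N$ invariant. As $N\to\infty$, for any polynomial $P\in\mathbb{C}\langle X_k,Y_k:k\in K\rangle$, $$\mathbb{E}\big[\psi_{\mathbf{A}_N,U_N\mathbf{B}_NU_N^\star}(P)\big]=(\psi_{\mathbf{A}_N}*\psi_{\mathbf{B}_N})(P)+O(N^{-1})$$ and $$\mathbb{E}\big[\varphi^{v_N}_{\mathbf{A}_N,U_N\mathbf{B}_NU_N^\star}(P)\big]=\big(\varphi^{v_N}_{\mathbf{A}_N}\,{}_{\psi_{\mathbf{A}_N}}\!*_{\psi_{\mathbf{B}_N}}\,\varphi^{v_N}_{\mathbf{B}_N}\big)(P)+O(N^{-1}),$$ uniformly for the choice of any sequences $\mathbf{A}_N=\{A_N^k:k\in K\}$ and $\mathbf{B}_N=\{B_N^k:k\in K\}$ ($N\ge1$) of families of deterministic $N\times N$ complex matrices bounded in operator norm by $R$.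
   Context: A uniform random unitary matrix leaving $v$ invariant is a random matrix distributed according to Haar measure on the compact group $\{U\in U(N):Uv=v\}$. Distributions: $\mathrm{tr}_N=\frac1N\mathrm{Tr}_N$. For a family $\mathbf{A}=\{A^k:k\in K\}$ of $N\times N$ matrices and $v\in\mathbb{C}^N$, define linear functionals on $\mathbb{C}\langle X_k:k\in K\rangle$ by $\psi_{\mathbf{A}}(P)=\mathrm{tr}_N(P(\mathbf{A}))$ and $\varphi^{v}_{\mathbf{A}}(P)=\mathrm{Tr}_N(vv^\star P(\mathbf{A}))$. For a pair of families, $\psi_{\mathbf{A},\mathbf{C}}(P)=\mathrm{tr}_N(P(\mathbf{A},\mathbf{C}))$ and $\varphi^v_{\mathbf{A},\mathbf{C}}(P)=\mathrm{Tr}_N(vv^\star P(\mathbf{A},\mathbf{C}))$ for $P\in\mathbb{C}\langle X_k,Y_k:k\in K\rangle$ ($X_k$ evaluated on $\mathbf{A}$, $Y_k$ on $\mathbf{C}$); $U\mathbf{B}U^\star=\{UB^kU^\star\}$. Products: for unital complex algebras $\mathcal{A}_1,\mathcal{A}_2$, $\mathcal{A}_1\star\mathcal{A}_2$ is the free product with identification of units (so $\mathbb{C}\langle X_k\rangle\star\mathbb{C}\langle Y_k\rangle=\mathbb{C}\langle X_k,Y_k\rangle$; the $\mathbf{B}$-functionals are viewed on $\mathbb{C}\langle Y_k\rangle$). A sequence $(a_1,\dots,a_n)$ in $\mathcal{A}_1\cup\mathcal{A}_2$ is alternating if $a_j\in\mathcal{A}_{i_j}$ with $i_1\ne i_2\neq\cdots\ne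 i_n$, and centered w.r.t. $\psi$ if $\psi(a_1)=\cdots=\psi(a_n)=0$. For unital linear functionals $\psi_i,\varphi_i:\mathcal{A}_i\to\mathbb{C}$, $\psi_1*\psi_2$ is the unique linear functional on $\mathcal{A}_1\star\mathcal{A}_2$ extending $\psi_1,\psi_2$ and vanishing on $a_1\cdots a_n$ for every alternating sequence centered w.r.t. it; $\varphi_1\,{}_{\psi_1}\!*_{\psi_2}\,\varphi_2$ is the unique linear functional $\varphi$ on $\mathcal{A}_1\star\mathcal{A}_2$ extending $\varphi_1,\varphi_2$ with $\varphi(a_1\cdots a_n)=\varphi(a_1)\cdots\varphi(a_n)$ for every alternating sequence centered w.r.t. $\psi_1*\psi_2$. Uniformity means: for each $P$ the constant in $O(N^{-1})$ does not depend on the choice of the families with all $\|A_N^k\|,\|B_N^k\|\le R$. *)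

(* Defs.v *)
From HB Require Import structures.
From mathcomp Require Import all_boot all_order all_algebra.
From mathcomp Require Import ring finmap spectral complex monalg.
From mathcomp Require Import all_classical all_reals all_analysis.

Set Implicit Arguments.
Unset Strict Implicit.
Unset Printing Implicit Defensive.

Import Order.TTheory GRing.Theory Num.Theory.
Import numFieldNormedType.Exports ComplexField.Normc.

Local Open Scope classical_set_scope.
Local Open Scope complex_scope.
Local Open Scope sesquilinear_scope.
Local Open Scope ring_scope.

(* free unital algebra F<X_i : i in I>, with basis the words over I *)
Notation ncpoly F I := {malg F[{fmonom I}]}.

Section NcPoly.
Context {F : fieldType} {I : choiceType}.
Implicit Types (P Q : ncpoly F I) (w : seq I).

Definition ncmono w : ncpoly F I := mkmalgU (FMonom w) 1.

Definition nclift (V : lmodType F) (h : seq I -> V) P : V :=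
  \sum_(w <- msupp P) P@_w *: h w.

Lemma ncliftEw (V : lmodType F) (h : seq I -> V) P (d : {fset {fmonom I}}) :
  (msupp P `<=` d)%fset -> nclift h P = \sum_(w <- d) P@_w *: h w.
Proof.
move=> le; rewrite [LHS](big_fset_incl _ le) => //= x _ /mcoeff_outdom ->.
by rewrite scale0r.
Qed.

Lemma nclift_linear (V : lmodType F) (h : seq I -> V) : linear (nclift h).
Proof.
move=> a P Q.
pose d := (msupp P `|` msupp Q)%fset.
rewrite (@ncliftEw _ h P d) ?fsubsetUl // (@ncliftEw _ h Q d) ?fsubsetUr //.
rewrite (@ncliftEw _ h (a *: P + Q) d); last first.
  apply: (fsubset_trans (msuppD_le _ _)); apply: fsetSU; exact: msuppZ_le.
rewrite scaler_sumr -big_split /=; apply: eq_bigr => w _.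
by rewrite mcoeffD mcoeffZ scalerDl scalerA.
Qed.

HB.instance Definition _ (V : lmodType F) (h : seq I -> V) :=
  GRing.isLinear.Build F (ncpoly F I) V *:%R (nclift h) (nclift_linear h).

Lemma nclift_mono (V : lmodType F) (h : seq I -> V) w :
  nclift h (ncmono w) = h w.
Proof.
rewrite (@ncliftEw _ h _ [fset FMonom w]%fset); last exact: msuppU_le.
by rewrite big_seq_fset1 mcoeffUU scale1r.
Qed.

Lemma ncpolyE P : P = \sum_(w <- msupp P) P@_w *: ncmono w.
Proof.
rewrite [LHS]monalgE; apply: eq_bigr => w _; apply/malgP => k.
by rewrite mcoeffZ /ncmono !mcoeffU mulrnAr mulr1 /= fmK.
Qed.

Lemma nclin_ext (V : lmodType F) (f g : ncpoly F I -> V) :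
  linear f -> linear g -> (forall w, f (ncmono w) = g (ncmono w)) -> f =1 g.
Proof.
move=> lf lg fg P.
pose f' := GRing.isLinear.Build _ _ _ _ f lf.
pose g' := GRing.isLinear.Build _ _ _ _ g lg.
pose fl : {linear ncpoly F I -> V} := HB.pack f f'.
pose gl : {linear ncpoly F I -> V} := HB.pack g g'.
rewrite -[f]/(fl : _ -> _) -[g]/(gl : _ -> _) [P]ncpolyE !linear_sum.
by apply: eq_bigr => w _; rewrite !linearZ /= fg.
Qed.

Lemma ncmono1 : ncmono [::] = 1.
Proof. by rewrite /ncmono -fmoneE. Qed.

Lemma ncmonoM w1 w2 : ncmono w1 * ncmono w2 = ncmono (w1 ++ w2).
Proof.
rewrite -[LHS]/(fgmul _ _) /ncmono fgmulUU mulr1; congr mkmalgU.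
by apply/eqP; rewrite fmP fmM.
Qed.

Lemma nc_scaleAr (c : F) P Q : P * (c *: Q) = c *: (P * Q).
Proof.
have e : mkmalgU (mone : {fmonom I}) c = c *: 1.
  apply/malgP => k; rewrite mcoeffZ -ncmono1 /ncmono -fmoneE !mcoeffU.
  by rewrite mulrnAr mulr1.
have -> : c *: Q = mkmalgU mone c * Q by rewrite mul_malgC.
rewrite mulrA.
suff -> : P * mkmalgU mone c = c *: P by rewrite scalerAl.
rewrite -[LHS]/(fgmul _ _) fgmulgU [in RHS](monalgE P) scaler_sumr.
apply: eq_bigr => k _; rewrite mulm1; apply/malgP => k'.
by rewrite mcoeffZ !mcoeffU mulrnAr mulrC.
Qed.

End NcPoly.

Section FreeProducts.
Context {F : fieldType} {K : choiceType}.
Implicit Types (a : ncpoly F K) (Q : ncpoly F (K + K)%type).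
Implicit Types (s : seq (bool * ncpoly F K)) (psi phi : bool -> ncpoly F K -> F).
Implicit Types (Psi Phi : ncpoly F (K + K)%type -> F).

(* The free product of two copies of ncpoly F K with units identified is
   ncpoly F (K + K): the letters X_k are inl k and the letters Y_k are inr k.
   An element of one of the two factors is a pair (b, a), where b = false for
   the X-factor and b = true for the Y-factor. *)
Definition letter (b : bool) (k : K) : (K + K)%type := if b then inr k else inl k.

Definition ncemb (b : bool) : ncpoly F K -> ncpoly F (K + K)%type :=
  nclift (fun w => ncmono (map (letter b) w)).

HB.instance Definition _ (b : bool) :=
  GRing.Linear.copy (ncemb b) (nclift (fun w => ncmono (map (letter b) w))).

Definition ncprod s : ncpoly F (K + K)%type := \prod_(p <- s) ncemb p.1 p.2.

Definition alternating s : bool := sorted (fun p q => p.1 != q.1) s.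

Definition centered Psi s : Prop :=
  forall p, p \in s -> Psi (ncemb p.1 p.2) = 0.

Definition is_free_product psi Psi : Prop :=
  [/\ scalar Psi,
      forall b a, Psi (ncemb b a) = psi b a &
      forall s, s != [::] -> alternating s -> centered Psi s ->
        Psi (ncprod s) = 0].

Definition is_cfree_product Psi phi Phi : Prop :=
  [/\ scalar Phi,
      forall b a, Phi (ncemb b a) = phi b a &
      forall s, s != [::] -> alternating s -> centered Psi s ->
        Phi (ncprod s) = \prod_(p <- s) Phi (ncemb p.1 p.2)].

Definition on_factors (f1 f2 : ncpoly F K -> F) (b : bool) :=
  if b then f2 else f1.

(* The functional satisfying the specification exists and is unique when the
   arguments are linear and unital: see free_productP, free_product_unique,
   cfree_productP and cfree_product_unique. *)
Definition free_product (psi1 psi2 : ncpoly F K -> F) :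
    ncpoly F (K + K)%type -> F :=
  xget (fun=> 0) (is_free_product (on_factors psi1 psi2)).

Definition cfree_product (psi1 psi2 phi1 phi2 : ncpoly F K -> F) :
    ncpoly F (K + K)%type -> F :=
  xget (fun=> 0)
    (is_cfree_product (free_product psi1 psi2) (on_factors phi1 phi2)).

End FreeProducts.

Section Distributions.
Context {F : numClosedFieldType} {I : choiceType} {n : nat}.
Implicit Types (A : I -> 'M[F]_n) (P : ncpoly F I) (v : 'cV[F]_n).

Definition nceval A : ncpoly F I -> 'M[F]_n :=
  nclift (fun w => \prod_(k <- w) A k).

HB.instance Definition _ A :=
  GRing.Linear.copy (nceval A) (nclift (fun w => \prod_(k <- w) A k)).

Definition tracial_dist A P : F := n%:R^-1 * \tr (nceval A P).

Definition vector_dist v A P : F := \tr (v *m v^t* *m nceval A P).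

Lemma tracial_dist_scalar A : scalar (tracial_dist A).
Proof.
by move=> c P Q; rewrite /tracial_dist !linearP /= mulrDr mulrCA.
Qed.

Lemma vector_dist_scalar v A : scalar (vector_dist v A).
Proof. by move=> c P Q; rewrite /vector_dist !linearP. Qed.

Lemma nceval1 A : nceval A 1 = 1%:M.
Proof. by rewrite -ncmono1 /nceval nclift_mono big_nil. Qed.

Lemma tracial_dist1 A : (0 < n)%N -> tracial_dist A 1 = 1.
Proof.
move=> n0; rewrite /tracial_dist nceval1 mxtrace1 mulVf //.
by rewrite pnatr_eq0 -lt0n.
Qed.

End Distributions.

Definition join_family {K1 K2 : Type} {T : Type} (A : K1 -> T) (C : K2 -> T)
    (x : K1 + K2) : T :=
  match x with inl k => A k | inr k => C k end.

Definition conj_family {F : numClosedFieldType} {K : Type} {n : nat}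
    (U : 'M[F]_n) (B : K -> 'M[F]_n) (k : K) : 'M[F]_n :=
  U *m B k *m U^t*.

Section RandomUnitary.
Variable R : realType.

Definition l2norm n (x : 'cV[R[i]]_n) : R :=
  Num.sqrt (\sum_(j < n) normc (x j 0) ^+ 2).

Lemma vector_dist1 (I : choiceType) n (v : 'cV[R[i]]_n) (A : I -> 'M[R[i]]_n) :
  l2norm v = 1 -> vector_dist v A 1 = 1.
Proof.
move=> v1; rewrite /vector_dist nceval1 mulmx1 /mxtrace.
have e : \sum_(j < n) normc (v j 0) ^+ 2 = 1.
  move/(congr1 (fun x => x ^+ 2)): v1; rewrite /l2norm sqr_sqrtr ?expr1n //.
  by apply: sumr_ge0 => j _; exact: sqr_ge0.
have -> : 1 = (1 : R)%:C by [].
rewrite -e rmorph_sum; apply: eq_bigr => j _.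
rewrite mxE big_ord1 !mxE rmorphXn /=.
by rewrite -[(normc _)%:C]/(`|v j 0|) normCK.
Qed.

Definition opnorm n (M : 'M[R[i]]_n) : R :=
  sup [set l2norm (M *m x) | x in [set x | l2norm x <= 1]].

(* R[i]^o carries the usual topology of the complex plane *)
Definition mxBorel n := g_sigma_algebraType (@open 'M[R[i]^o]_n).

Definition stab_unitary n (v : 'cV[R[i]]_n) : set 'M[R[i]]_n :=
  [set U | U \is unitarymx /\ U *m v = v].

(* Haar probability measure of a compact matrix group G, as a Borel measure on
   the space of all matrices that is concentrated on G *)
Definition is_haar n (G : set 'M[R[i]]_n) (mu : set (mxBorel n) -> \bar R) :=
  mu G = 1%E /\
  forall (W : 'M[R[i]]_n) (S : set (mxBorel n)), G W -> measurable S ->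
    mu [set W *m M | M in S] = mu S.

Definition uniform_stab_unitary d (T : measurableType d) (Pr : probability T R)
    n (v : 'cV[R[i]]_n) (U : {RV Pr >-> mxBorel n}) : Prop :=
  is_haar (stab_unitary v) (distribution Pr U).

Definition cexpectation d (T : measurableType d) (Pr : probability T R)
    (Z : T -> R[i]) : R[i] :=
  fine 'E_Pr[fun t => complex.Re (Z t)] +i* fine 'E_Pr[fun t => complex.Im (Z t)].

Definition uniformly_O_inv (K : Type) (r : R)
    (err : forall N, (K -> 'M[R[i]]_N.+1) -> (K -> 'M[R[i]]_N.+1) -> R[i]) :=
  exists (C : R) (N0 : nat),
    forall A B : forall N, K -> 'M[R[i]]_N.+1,
      (forall N k, opnorm (A N k) <= r) -> (forall N k, opnorm (B N k) <= r) ->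
    forall N, (N0 <= N)%N -> normc (err N (A N) (B N)) <= C / N.+1%:R.

End RandomUnitary.

(* Existence and uniqueness of c-free products, for abstract algebras A (one
   factor) and B (the free product) with given word bases. *)
Section StackEvaluation.
Context {F : fieldType} {K : choiceType} {A B : lalgType F}.
Variable mono : seq K -> A.
Hypothesis mono1 : mono [::] = 1.
Hypothesis monoM : forall u w, mono u * mono w = mono (u ++ w).
Hypothesis scaleArA : forall (k : F) (a c : A), a * (k *: c) = k *: (a * c).
Hypothesis extA : forall (V : lmodType F) (f g : A -> V), linear f -> linear g ->
  (forall w, f (mono w) = g (mono w)) -> f =1 g.
Variable monoB : seq (K + K) -> B.
Hypothesis monoB1 : monoB [::] = 1.
Hypothesis monoBM : forall u w, monoB u * monoB w = monoB (u ++ w).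
Hypothesis scaleArB : forall (k : F) (a c : B), a * (k *: c) = k *: (a * c).
Hypothesis extB : forall (V : lmodType F) (f g : B -> V), linear f -> linear g ->
  (forall w, f (monoB w) = g (monoB w)) -> f =1 g.
Variable lift : (seq (K + K) -> F) -> B -> F.
Hypothesis lift_lin : forall h, scalar (lift h).
Hypothesis lift_mono : forall h w, lift h (monoB w) = h w.
Variable emb : bool -> {linear A -> B}.
Hypothesis emb_mono : forall b w, emb b (mono w) = monoB (map (letter b) w).
Variables psi phi : bool -> A -> F.
Hypothesis psi_lin : forall b, scalar (psi b).
Hypothesis phi_lin : forall b, scalar (phi b).
Hypothesis psi_unit : forall b, psi b 1 = 1.
Hypothesis phi_unit : forall b, phi b 1 = 1.
Implicit Types (b : bool) (a c : A) (s : seq (bool * A)) (r : seq (K + K)%type).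

Let psiD b a c : psi b (a + c) = psi b a + psi b c.
Proof. by rewrite -[a in LHS]scale1r psi_lin /= mul1r. Qed.
Let psi0 b : psi b 0 = 0.
Proof. by have := psiD b 0 0; rewrite addr0 -[X in X = _]addr0 => /addrI <-. Qed.
Let psiZ b k a : psi b (k *: a) = k * psi b a.
Proof. by rewrite -[k *: a]addr0 psi_lin psi0 addr0. Qed.
Let phiD b a c : phi b (a + c) = phi b a + phi b c.
Proof. by rewrite -[a in LHS]scale1r phi_lin /= mul1r. Qed.
Let phi0 b : phi b 0 = 0.
Proof. by have := phiD b 0 0; rewrite addr0 -[X in X = _]addr0 => /addrI <-. Qed.
Let phiZ b k a : phi b (k *: a) = k * phi b a.
Proof. by rewrite -[k *: a]addr0 phi_lin phi0 addr0. Qed.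

Let ctr b a := a - psi b a *: 1.
Let ctr_lin b (k : F) a c : ctr b (k *: a + c) = k *: ctr b a + ctr b c.
Proof.
rewrite /ctr psi_lin.
rewrite [(k * _ + _) *: 1]scalerDl.
rewrite -[(k * _) *: 1]scalerA.
rewrite [k *: (a - _)]scalerBr.
by rewrite opprD addrACA.
Qed.
Let psi_ctr b a : psi b (ctr b a) = 0.
Proof. by rewrite /ctr -scaleNr psiD psiZ psi_unit mulr1 subrr. Qed.
Let ctr_id b a : psi b a = 0 -> ctr b a = a.
Proof. by rewrite /ctr => ->; rewrite scale0r subr0. Qed.
Let ctrE b a : a = ctr b a + psi b a *: 1.
Proof. by rewrite subrK. Qed.

Let side (x : (K + K)%type) : bool := if x is inr _ then true else false.
Let gen (x : (K + K)%type) : A :=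
  mono [:: match x with inl k => k | inr k => k end].

Let popt b s := if s is (b', t) :: _ then if b' == b then t else 1 else 1.
Let pops b s := if s is (b', t) :: s' then if b' == b then s' else s else [::].

(* H s w is the value at (product of the stack s, top last) * w: the next
   letter is merged with the top of the stack if they come from the same
   factor, and the result is split into its centered part, which is pushed,
   and its mean, which is factored out *)
Let Fixpoint H s (r : seq (K + K)%type) : F :=
  if r is x :: r' then
    let b := side x in
    let c := popt b s * gen x in
    H ((b, ctr b c) :: pops b s) r' + psi b c * H (pops b s) r'
  else \prod_(p <- s) phi p.1 p.2.

Let dist1 (k x1 x2 y1 y2 z : F) :
  k * x1 + x2 + (k * y1 + y2) * z = k * (x1 + y1 * z) + (x2 + y2 * z).
Proof. by ring. Qed.
Let dist2 (k x1 x2 y1 y2 z : F) :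
  k * x1 + x2 + z * (k * y1 + y2) = k * (x1 + z * y1) + (x2 + z * y2).
Proof. by ring. Qed.

Let dist3 (x1 x2 x3 p q y : F) :
  x1 + q * x3 + p * (x2 + y * x3) = p * x2 + x1 + (q + p * y) * x3.
Proof. by ring. Qed.

Let dist4 (k x p1 p2 q1 q2 : F) :
  k * (x * p1 + p2) + (x * q1 + q2) = x * (k * p1 + q1) + (k * p2 + q2).
Proof. by ring. Qed.

Let H_lin s1 s2 b (k : F) a c r :
  H (s1 ++ (b, k *: a + c) :: s2) r =
  k * H (s1 ++ (b, a) :: s2) r + H (s1 ++ (b, c) :: s2) r.
Proof.
elim: r s1 s2 b a c => [|x r IH] s1 s2 b a c /=.
  by rewrite !big_cat !big_cons /= phi_lin; ring.
case: s1 => [|[b1 t] s1] /=.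
  case: eqP => _.
    rewrite mulrDl -scalerAl ctr_lin.
    rewrite (IH [::]) psi_lin /=.
    exact: dist1.
  by rewrite (IH [:: _]) (IH [::])  /=; exact: dist2.
case: eqP => _.
  by rewrite (IH (_ :: s1)) (IH s1)  /=; exact: dist2.
by rewrite (IH [:: _, _ & s1]) (IH (_ :: s1))  /=; exact: dist2.
Qed.

Let H_nil s : H s [::] = \prod_(p <- s) phi p.1 p.2.
Proof. by []. Qed.

Let H_cons s x r : H s (x :: r) =
  H ((side x, ctr (side x) (popt (side x) s * gen x)) :: pops (side x) s) r
  + psi (side x) (popt (side x) s * gen x) * H (pops (side x) s) r.
Proof. by []. Qed.

Let alt s := sorted (fun p q => p.1 != q.1) s.

Let good s := alt s /\ forall p, p \in s -> psi p.1 p.2 = 0.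

Let alt_cons p s :
  alt (p :: s) = (if s is q :: _ then p.1 != q.1 else true) && alt s.
Proof. by case: s. Qed.

Let fresh b s := if s is q :: _ then b != q.1 else true.

Let good_pops b s : good s -> good (pops b s) /\ fresh b (pops b s).
Proof.
case: s => [|[b' t] s] //= [al ce].
case: eqVneq => [<-|nb].
  move: al; rewrite alt_cons /fresh; case: s ce => [|q s] ce //= /andP[h1 h2].
  by split=> //; split=> // p ps; apply: ce; rewrite inE ps orbT.
by rewrite /fresh /= eq_sym nb.
Qed.

Let fresh_pop b s : fresh b s -> pops b s = s /\ popt b s = 1.
Proof. by case: s => [|[b' t] s] //=; rewrite eq_sym => /negPf ->. Qed.

Let good_push b a s : good s -> fresh b s -> psi b a = 0 -> good ((b, a) :: s).
Proof.
move=> [al ce] fr a0; split; first by rewrite alt_cons al andbT; case: s fr al ce.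
by move=> p; rewrite inE => /predU1P[->|/ce].
Qed.

Let mul_ctr b a c : a * c = ctr b a * c + psi b a *: c.
Proof. by rewrite [ctr b a * c]mulrBl -[psi b a *: 1 * c]scalerAl mul1r subrK. Qed.

Let psi_ctrM b a c : psi b (ctr b a * c) + psi b a * psi b c = psi b (a * c).
Proof. by rewrite -psiZ -psiD -mul_ctr. Qed.

Let ctr_ctrM b a c : ctr b (a * c) = psi b a *: ctr b c + ctr b (ctr b a * c).
Proof. by rewrite -ctr_lin [_ + ctr b a * c]addrC -mul_ctr. Qed.

Let H_word b u s r : good s ->
  H s (map (letter b) u ++ r) =
  H ((b, ctr b (popt b s * mono u)) :: pops b s) r
  + psi b (popt b s * mono u) * H (pops b s) r.
Proof.
clearbody H; elim: u s => [|k u IH] s gs.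
  rewrite /= mono1 mulr1.
  case: s gs => [|[b' t] s] gs /=.
    rewrite psi_unit mul1r (_ : ctr b 1 = 0 *: 0 + 0); last first.
      by rewrite /ctr psi_unit scale1r subrr scaler0 addr0.
    have := H_lin [::] [::] b 0 0 0 r; rewrite /= mul0r add0r => ->.
    have := H_lin [::] [::] b 0 0 0 r; rewrite scaler0 addr0 mul0r add0r /= => e.
    have z : H [:: (b, 0)] r = 0.
      have := H_lin [::] [::] b (-1) 0 0 r.
      by rewrite /= scaler0 addr0 mulN1r addNr.
    by rewrite z add0r.
  case: eqVneq => [e|nb].
    subst b'; have t0 : psi b t = 0 by apply: (gs.2 (b, t)); rewrite inE eqxx.
    by rewrite ctr_id // t0 mul0r addr0.
  have z : H [:: (b, 0), (b', t) & s] r = 0.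
    have := H_lin [::] ((b', t) :: s) b (-1) 0 0 r.
    by rewrite /= scaler0 addr0 mulN1r addNr.
  by rewrite /ctr psi_unit scale1r subrr z add0r mul1r.
have sl : side (letter b k) = b by case: b {IH}.
have gl : gen (letter b k) = mono [:: k] by rewrite /gen; case: b {IH sl}.
have [gp fp] := good_pops b gs.
rewrite /= H_cons sl gl.
have gpush : good ((b, ctr b (popt b s * mono [:: k])) :: pops b s).
  exact: good_push.
have e1 := IH _ gpush; rewrite /= eqxx in e1.
have e2 := IH _ gp.
have [fp1 fp2] := fresh_pop fp; rewrite fp1 fp2 mul1r in e2.
refine (etrans (congr2 (fun x y => x + _ * y) e1 e2) _) => {e1 e2}.
set t := popt b s; set s' := pops b s.
have -> : t * mono (k :: u) = t * mono [:: k] * mono u.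
  by rewrite -mulrA monoM.
set c := t * mono [:: k].
have e3 := H_lin [::] s' b (psi b c) (ctr b (mono u))
  (ctr b (ctr b c * mono u)) r.
rewrite -ctr_ctrM /= in e3; rewrite e3 -(psi_ctrM b c).
exact: dist3.
Qed.


Let Hx s : B -> F := lift (H s).

Let HxD s (P Q : B) : Hx s (P + Q) = Hx s P + Hx s Q.
Proof. by rewrite -[P in LHS]scale1r /Hx lift_lin mul1r. Qed.
Let Hx0 s : Hx s 0 = 0.
Proof. by have := HxD s 0 0; rewrite addr0 -[X in X = _]addr0 => /addrI <-. Qed.
Let HxZ s (c : F) (Q : B) : Hx s (c *: Q) = c * Hx s Q.
Proof. by rewrite -[c *: Q]addr0 /Hx lift_lin -/(Hx s 0) Hx0 addr0. Qed.
Let Hx_lin s : linear (Hx s : _ -> F^o).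
Proof. exact: lift_lin. Qed.
Let Hx_mono s r : Hx s (monoB r) = H s r.
Proof. exact: lift_mono. Qed.

Let Hx_slot s b (k : F) a c (Q : B) :
  Hx ((b, k *: a + c) :: s) Q = k * Hx ((b, a) :: s) Q + Hx ((b, c) :: s) Q.
Proof.
pose f Q := (Hx ((b, k *: a + c) :: s) Q : F^o).
pose g Q := (k * Hx ((b, a) :: s) Q + Hx ((b, c) :: s) Q : F^o).
suff : f =1 g by apply.
apply: extB => [|x p q|w]; first exact: Hx_lin.
- rewrite /g !HxD !HxZ; exact: dist4.
by rewrite /f /g !Hx_mono (H_lin [::]).
Qed.

Let Hx_emb s b a (Q : B) : good s ->
  Hx s (emb b a * Q) =
  Hx ((b, ctr b (popt b s * a)) :: pops b s) Q
  + psi b (popt b s * a) * Hx (pops b s) Q.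
Proof.
clearbody Hx => gs.
pose f a := (Hx s (emb b a * Q) : F^o).
pose g a := (Hx ((b, ctr b (popt b s * a)) :: pops b s) Q
  + psi b (popt b s * a) * Hx (pops b s) Q : F^o).
suff : f =1 g by apply.
apply: extA.
- by move=> k c d; rewrite /f linearP mulrDl -scalerAl HxD HxZ.
- move=> k c d; rewrite /g mulrDr scaleArA ctr_lin psi_lin Hx_slot.
  exact: dist1.
move=> u; rewrite /f /g {f g}.
pose f Q := (Hx s (emb b (mono u) * Q) : F^o).
pose g Q := (Hx ((b, ctr b (popt b s * mono u)) :: pops b s) Q
  + psi b (popt b s * mono u) * Hx (pops b s) Q : F^o).
suff : f =1 g by apply.
apply: extB.
- by move=> k c d; rewrite /f mulrDr scaleArB HxD HxZ.
- by move=> k c d; rewrite /g !HxD !HxZ; exact: dist2.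
by move=> r; rewrite /f /g emb_mono monoBM !Hx_mono H_word.
Qed.

Let emb1 b : emb b 1 = 1.
Proof. by rewrite -mono1 emb_mono /= monoB1. Qed.

Let embM b (a c : A) : emb b (a * c) = emb b a * emb b c.
Proof.
move: a; apply: extA => [k p q|k p q|u].
- by rewrite mulrDl -scalerAl linearP.
- by rewrite linearP mulrDl -scalerAl.
move: c; apply: extA => [k p q|k p q|w].
- by rewrite mulrDr scaleArA linearP.
- by rewrite linearP mulrDr scaleArB.
by rewrite monoM !emb_mono monoBM map_cat.
Qed.

Let good_nil : good [::]. Proof. by []. Qed.

Let Hx1 s : Hx s 1 = \prod_(p <- s) phi p.1 p.2.
Proof. by rewrite -monoB1 Hx_mono. Qed.

Let Phi_ext b a : Hx [::] (emb b a) = phi b a.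
Proof.
clearbody Hx.
rewrite -[emb b a]mulr1 Hx_emb //= mul1r !Hx1 big_cons !big_nil !mulr1 /=.
by rewrite [in RHS](ctrE b a) phiD phiZ phi_unit mulr1.
Qed.

Let prodB s : B := \prod_(p <- s) emb p.1 p.2.

Let Hx_prod s0 s : good s0 -> alt s ->
  (forall p, p \in s -> psi p.1 p.2 = 0) ->
  (if s is p :: _ then fresh p.1 s0 else true) ->
  Hx s0 (prodB s) = (\prod_(p <- s0) phi p.1 p.2) * \prod_(p <- s) phi p.1 p.2.
Proof.
clearbody Hx; elim: s s0 => [|[b a] s IH] s0 g0 al ce fr.
  by rewrite /prodB !big_nil Hx1 mulr1.
rewrite /prodB big_cons -/(prodB s) Hx_emb //=.
have [-> ->] := fresh_pop fr; rewrite mul1r.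
have a0 : psi b a = 0 by apply: (ce (b, a)); rewrite inE eqxx.
rewrite ctr_id // a0 mul0r addr0 IH.
- by rewrite !big_cons /= mulrA (mulrC (phi b a)).
- exact: good_push.
- by move: al; rewrite alt_cons => /andP[].
- by move=> p ps; apply: ce; rewrite inE ps orbT.
by move: al; rewrite alt_cons /fresh => /andP[+ _]; case: (s) => //= q _; rewrite eq_sym.
Qed.

Let is_cfp (Phi : B -> F) := [/\ scalar Phi, forall b a, Phi (emb b a) = phi b a &
  forall s, s != [::] -> alt s -> (forall p, p \in s -> psi p.1 p.2 = 0) ->
    Phi (prodB s) = \prod_(p <- s) phi p.1 p.2].

Let is_cfpP : is_cfp (Hx [::]).
Proof.
split=> [|b a|s _ al ce]; [exact: lift_lin|exact: Phi_ext|].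
by rewrite Hx_prod // ?big_nil ?mul1r //; case: (s).
Qed.

Let is_cfp_uniq Phi : is_cfp Phi -> Phi =1 Hx [::].
Proof.
move=> [lin ext cfp].
have PD P Q : Phi (P + Q) = Phi P + Phi Q.
  by rewrite -[P in LHS]scale1r lin mul1r.
have P0 : Phi 0 = 0.
  by have := PD 0 0; rewrite addr0 -[X in X = _]addr0 => /addrI <-.
have PZ k Q : Phi (k *: Q) = k * Phi Q by rewrite -[k *: Q]addr0 lin P0 addr0.
suff main r s : good s -> Phi (prodB (rev s) * monoB r) = H s r.
  apply: (extB (V := F^o)); [exact: lin|exact: Hx_lin|move=> r].
  by rewrite Hx_mono -main // /prodB big_nil mul1r.
clearbody Hx H; elim: r s => [|x r IH] s gs.
  rewrite H_nil monoB1 mulr1; case: (eqVneq s [::]) => [->|s0].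
    by rewrite /prodB /= !big_nil -(emb1 true) ext phi_unit.
  rewrite cfp /=.
  - by rewrite -[in RHS](revK s) [RHS]big_rev.
  - by rewrite -size_eq0 size_rev size_eq0.
  - rewrite /alt rev_sorted; case: gs => + _; rewrite /alt.
    by congr is_true; apply: eq_sorted => p q; rewrite eq_sym.
  - by move=> p; rewrite mem_rev => /gs.2.
have [gp fp] := good_pops (side x) gs.
have stk : prodB (rev s) =
    prodB (rev (pops (side x) s)) * emb (side x) (popt (side x) s).
  rewrite /pops /popt; case: (s) => [|[b t] s'] /=.
    by rewrite /prodB big_nil emb1 mulr1.
  case: eqP => [->|_]; last by rewrite emb1 mulr1.
  by rewrite rev_cons -cats1 /prodB big_cat /= big_seq1.
have gx : monoB [:: x] = emb (side x) (gen x).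
  by rewrite /gen emb_mono; case: x {stk gp fp}.
rewrite -(monoBM [:: x] r) gx mulrA stk -(mulrA _ (emb _ _) (emb _ _)) -embM H_cons.
set c := _ * gen x; set b := side x; set s' := pops b s.
rewrite {1}(ctrE b c) linearD linearZ /= emb1.
rewrite mulrDr scaleArB mulr1 mulrDl -scalerAl PD PZ IH //; congr (_ + _).
rewrite -IH; last exact: good_push.
by rewrite rev_cons -cats1 /prodB big_cat /= big_seq1.
Qed.

Lemma cfp_exists_unique : exists Phi : B -> F,
  let cfp Phi := [/\ scalar Phi, forall b a, Phi (emb b a) = phi b a &
  forall s, s != [::] -> sorted (fun p q => p.1 != q.1) s ->
    (forall p, p \in s -> psi p.1 p.2 = 0) ->
    Phi (\prod_(p <- s) emb p.1 p.2) = \prod_(p <- s) phi p.1 p.2] in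
  cfp Phi /\ forall Phi', cfp Phi' -> Phi' =1 Phi.
Proof. by exists (Hx [::]); split; [exact: is_cfpP|exact: is_cfp_uniq]. Qed.

End StackEvaluation.

Section FreeProductsWellDefined.
Context {F : fieldType} {K : choiceType}.
Variables psi1 psi2 : ncpoly F K -> F.
Hypotheses (psi1_lin : scalar psi1) (psi2_lin : scalar psi2).
Hypotheses (psi1_1 : psi1 1 = 1) (psi2_1 : psi2 1 = 1).

Let cfree_exu (f1 f2 : ncpoly F K -> F) :
    scalar f1 -> scalar f2 -> f1 1 = 1 -> f2 1 = 1 ->
  exists Phi : ncpoly F (K + K)%type -> F,
  let cfp Phi := [/\ scalar Phi,
      forall b a, Phi (ncemb b a) = on_factors f1 f2 b a &
      forall s, s != [::] -> alternating s ->
        (forall p, p \in s -> on_factors psi1 psi2 p.1 p.2 = 0) ->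
        Phi (ncprod s) = \prod_(p <- s) on_factors f1 f2 p.1 p.2] in
  cfp Phi /\ forall Phi', cfp Phi' -> Phi' = Phi.
Proof.
move=> f1_lin f2_lin f1_1 f2_1.
have lin (g1 g2 : ncpoly F K -> F) : scalar g1 -> scalar g2 ->
    forall b, scalar (on_factors g1 g2 b) by move=> ? ? [].
have unit (g1 g2 : ncpoly F K -> F) : g1 1 = 1 -> g2 1 = 1 ->
    forall b, on_factors g1 g2 b 1 = 1 by move=> ? ? [].
have [Phi [HPhi uniq]] := cfp_exists_unique ncmono1 ncmonoM nc_scaleAr
  (@nclin_ext _ _) ncmono1 ncmonoM nc_scaleAr (@nclin_ext _ _)
  (fun h => @nclift_linear _ _ F^o h) (@nclift_mono _ _ F^o)
  (emb := fun b => ncemb b) (fun b w => nclift_mono _ w)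
  (lin _ _ psi1_lin psi2_lin) (lin _ _ f1_lin f2_lin)
  (unit _ _ psi1_1 psi2_1) (unit _ _ f1_1 f2_1).
by exists Phi; split=> // Phi' /uniq/funext.
Qed.

Let free_exu : exists Psi, is_free_product (on_factors psi1 psi2) Psi /\
  forall Psi', is_free_product (on_factors psi1 psi2) Psi' -> Psi' = Psi.
Proof.
have [Psi [[Psi_lin Psi_ext Psi0] uniq]] :=
  cfree_exu psi1_lin psi2_lin psi1_1 psi2_1.
have prod0 (s : seq (bool * ncpoly F K)) : s != [::] ->
    (forall p, p \in s -> on_factors psi1 psi2 p.1 p.2 = 0) ->
    \prod_(p <- s) on_factors psi1 psi2 p.1 p.2 = 0.
  by case: s => // p s _ ce; rewrite big_cons ce ?mul0r // inE eqxx.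
exists Psi; split; first split=> // s s0 al ce.
  have ce' p : p \in s -> on_factors psi1 psi2 p.1 p.2 = 0.
    by move=> /ce; rewrite Psi_ext.
  by rewrite Psi0 // prod0.
move=> Psi' [lin' ext' prod']; apply: uniq; split=> // s s0 al ce.
by rewrite prod0 // prod' // => p /ce; rewrite ext'.
Qed.

Lemma free_productP :
  is_free_product (on_factors psi1 psi2) (free_product psi1 psi2).
Proof.
have [Psi [HPsi _]] := free_exu.
exact: (xgetPex (fun=> 0) (ex_intro _ Psi HPsi)).
Qed.

Lemma free_product_unique Psi :
  is_free_product (on_factors psi1 psi2) Psi -> Psi = free_product psi1 psi2.
Proof.
have [Psi0 [_ uniq]] := free_exu.
by move=> /uniq ->; rewrite (uniq _ free_productP).
Qed.

Variables phi1 phi2 : ncpoly F K -> F.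
Hypotheses (phi1_lin : scalar phi1) (phi2_lin : scalar phi2).
Hypotheses (phi1_1 : phi1 1 = 1) (phi2_1 : phi2 1 = 1).

Let is_cfree :=
  is_cfree_product (free_product psi1 psi2) (on_factors phi1 phi2).

Let cfree_product_exu :
  exists Phi, is_cfree Phi /\ forall Phi', is_cfree Phi' -> Phi' = Phi.
Proof.
have [_ Psi_ext _] := free_productP.
have [Phi [[Phi_lin Phi_ext Phi_prod] uniq]] :=
  cfree_exu phi1_lin phi2_lin phi1_1 phi2_1.
exists Phi; split; first split=> // s s0 al ce.
  rewrite Phi_prod // => [|p /ce]; last by rewrite Psi_ext.
  by apply: eq_bigr => p _; rewrite Phi_ext.
move=> Phi' [lin' ext' prod']; apply: uniq; split=> // s s0 al ce.
rewrite prod' // => [|p /ce]; last by rewrite Psi_ext.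
by apply: eq_bigr => p _; rewrite ext'.
Qed.

Lemma cfree_productP : is_cfree_product (free_product psi1 psi2)
  (on_factors phi1 phi2) (cfree_product psi1 psi2 phi1 phi2).
Proof.
have [Phi [HPhi _]] := cfree_product_exu.
exact: (xgetPex (fun=> 0) (ex_intro _ Phi HPhi)).
Qed.

Lemma cfree_product_unique Phi :
  is_cfree_product (free_product psi1 psi2) (on_factors phi1 phi2) Phi ->
  Phi = cfree_product psi1 psi2 phi1 phi2.
Proof.
have [Phi0 [_ uniq]] := cfree_product_exu.
by move=> /uniq ->; rewrite (uniq _ cfree_productP).
Qed.

End FreeProductsWellDefined.

(* Main.v *)
Require Import Defs.
From HB Require Import structures.
From mathcomp Require Import all_boot all_order all_algebra.
From mathcomp Require Import ring lra finmap spectral complex monalg.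
From mathcomp Require Import all_classical all_reals all_analysis.
From mathcomp Require Import measurable_realfun.

Set Implicit Arguments.
Unset Strict Implicit.
Unset Printing Implicit Defensive.

Import Order.TTheory GRing.Theory Num.Theory.
Import numFieldNormedType.Exports ComplexField.Normc.

Local Open Scope classical_set_scope.
Local Open Scope complex_scope.
Local Open Scope sesquilinear_scope.
Local Open Scope ring_scope.

(** Write n for the dimension, p = v v* and Q = 1 - p, and let C = U B U*.
    The law of U is invariant under U |-> W U for every unitary W that fixes v.
    Differentiating along curves of such W shows that E(D_X h) = 0 for every
    polynomial observable h and every X = Q X Q, where D_X is the derivation that
    kills the letters A and sends C to X C - C X ([mean_tangent],
    [schwinger_dyson]).  Take for h the trace of x e_mk w, where a matrix unit
    e_mk has been inserted after the first letter x of a word, multiplied by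
    another observable F; take X = Q e_km Q and sum over k and m.  In the
    resulting [loop_equation] each occurrence of X cuts the word into two
    traces.  The cut next to the matrix unit produces (n - 1) tr(x Q w); all the
    others produce the trace of h Q for some shorter subword h, times a rest,
    and the derivative of F contributes a bounded term.

    If the word alternates between the two families and its letters have trace
    zero, so do the subwords h.  Induction on the length therefore gives
    E(tr(word) F) = O(1/n) for the normalized trace, uniformly over letters of
    norm at most 1 and over all F of modulus at most 1 with gradient below a
    given bound ([tracial_bound_all]).  Products of traces are such F, so the
      rest produced
    by a cut is absorbed into F, and no concentration of measure is needed to
    separate the expectation of a product of traces.

    For the vector state phi = <v, . v> the same equation gives
    E(phi(x Q w)) = O(1/n), while phi(x p w) = phi(x) phi(w) and phi(x) is
    deterministic because U fixes v.  Hence phi factorizes over alternating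
    words of traceless letters up to O(1/n) ([vector_bound_all]).

    These two estimates are the relations that define the free and the
    conditionally free product.  Thus the difference between the expected
    distribution and the product is a linear functional that vanishes on each
    factor and is O(1/n) on alternating centered products; centering the
    letters one at a time and merging neighbours from the same factor reduces
    every monomial to this case, with constants that depend on the length and on
    the norm bound alone ([err_ncprod], [err_bound]). *)

(** * Borel measurability of matrix functions *)

Section Measurability.
Variables (R : realType) (n : nat).
Local Notation C := R[i].
Local Notation M := 'M[C^o]_n.

Lemma open_measurable_mx (A : set (mxBorel R n)) :
  open (A : set M) -> measurable A.
Proof. by move=> oA; apply: sub_sigma_algebra. Qed.

Lemma continuous_mx_measurable (f : M -> R) : continuous f ->
  measurable_fun [set: mxBorel R n] (f : mxBorel R n -> R).
Proof.
move=> /continuousP cf; apply: (measurability _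
  (measurable_realfun.RGenOpens.measurableE R)).
move=> _ [_ [a [b ->] <-]]; rewrite setTI; apply: open_measurable_mx.
exact/cf/interval_open.
Qed.

Lemma entry_continuous i j : continuous (fun X : M => X i j : C^o).
Proof.
move=> X A /= nA; exists (fun k l => if (k == i) && (l == j) then A else setT).
  by move=> k l; case: ifPn => [/andP[/eqP-> /eqP->]//|_]; exact: filterT.
by move=> Y /(_ i j); rewrite !eqxx.
Qed.

Lemma Re_continuous : continuous (fun z : C^o => complex.Re z).
Proof.
move=> z A /= /nbhs_ballP[e e0 sA].
apply/nbhs_ballP; exists (e%:C); first by rewrite /= ltcR.
move=> w /= zw; apply: sA; move: zw; rewrite -!ball_normE /= => zw.
by rewrite -ltcR -raddfB; apply: le_lt_trans zw; exact: normc_ge_Re.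
Qed.

Lemma Im_continuous : continuous (fun z : C^o => complex.Im z).
Proof.
move=> z A /= /nbhs_ballP[e e0 sA].
apply/nbhs_ballP; exists (e%:C); first by rewrite /= ltcR.
move=> w /= zw; apply: sA; move: zw; rewrite -!ball_normE /= => zw.
rewrite -ltcR -raddfB; apply: le_lt_trans zw; rewrite normc_def lecR.
by rewrite -sqrtr_sqr ler_wsqrtr // lerDr sqr_ge0.
Qed.

Lemma mul_continuous (W : 'M[C]_n) : continuous (fun X : M => W *m X : M).
Proof.
move=> X A /= [P nP sP].
have h (ij : 'I_n * 'I_n) : \forall Y \near X, P ij.1 ij.2 ((W *m Y) ij.1 ij.2).
  have c : continuous (fun Y : M => \sum_k W ij.1 k * Y k ij.2 : C^o).
    apply: continuous_big => [|k _ Y].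
      exact: add_continuous.
    apply: (@continuous_comp M C^o C^o (fun Y : M => Y k ij.2 : C^o)
      (fun z : C^o => W ij.1 k * z : C^o)); first exact: entry_continuous.
    exact: mulrl_continuous.
  have e : (fun Y : M => \sum_k W ij.1 k * Y k ij.2 : C^o) =
      (fun Y : M => (W *m Y) ij.1 ij.2) by apply/funext => Y; rewrite mxE.
  by rewrite e in c; exact: (c X _ (nP ij.1 ij.2)).
have {}h := @filter_forall _ _ _ (nbhs X) (nbhs_filter X) h.
rewrite /nbhs /=; move: h; apply: (@filterS _ _ (nbhs_filter X)) => Y hY.
by apply: sP => i j; exact: (hY (i, j)).
Qed.

Lemma mul_measurable (W : 'M[C]_n) :
  measurable_fun [set: mxBorel R n] (fun X : mxBorel R n => W *m X : mxBorel R n).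
Proof.
apply: (@measurability _ _ (mxBorel R n) (mxBorel R n) setT _ (@open M)) => //.
move=> _ [A oA <-]; rewrite setTI.
apply: open_measurable_mx; have /continuousP c := @mul_continuous W.
exact: c.
Qed.

Definition cmeasurable (h : 'M[C]_n -> C) :=
  measurable_fun [set: mxBorel R n] (fun X : mxBorel R n => complex.Re (h X)) /\
  measurable_fun [set: mxBorel R n] (fun X : mxBorel R n => complex.Im (h X)).

Lemma cmeasurable_entry i j : cmeasurable (fun X => X i j).
Proof.
split; apply: continuous_mx_measurable => X.
- apply: (@continuous_comp M C^o R (fun X : M => X i j : C^o) (fun z : C^o =>
  complex.Re z)).
    exact: entry_continuous.
  exact: Re_continuous.
- apply: (@continuous_comp M C^o R (fun X : M => X i j : C^o) (fun z : C^o =>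
  complex.Im z)).
    exact: entry_continuous.
  exact: Im_continuous.
Qed.

Lemma cmeasurable_cst c : cmeasurable (fun=> c).
Proof. by split; exact: measurable_cst. Qed.

Lemma cmeasurableD f g : cmeasurable f -> cmeasurable g ->
  cmeasurable (fun X => f X + g X).
Proof.
move=> [f1 f2] [g1 g2]; split.
- by under eq_fun do rewrite raddfD; exact: measurable_funD.
- by under eq_fun do rewrite raddfD; exact: measurable_funD.
Qed.

Lemma cmeasurableM f g : cmeasurable f -> cmeasurable g ->
  cmeasurable (fun X => f X * g X).
Proof.
move=> [f1 f2] [g1 g2]; split.
- rewrite (_ : (fun _ => _) = (fun X => complex.Re (f X) * complex.Re (g X)
    - complex.Im (f X) * complex.Im (g X))); last first.
    by apply/funext => X; case: (f X) (g X) => [a b] [c d].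
  by apply: measurable_funB; exact: measurable_funM.
- rewrite (_ : (fun _ => _) = (fun X => complex.Re (f X) * complex.Im (g X)
    + complex.Im (f X) * complex.Re (g X))); last first.
    by apply/funext => X; case: (f X) (g X) => [a b] [c d].
  by apply: measurable_funD; exact: measurable_funM.
Qed.

Lemma cmeasurableJ f : cmeasurable f -> cmeasurable (fun X => (f X)^*).
Proof.
move=> [f1 f2]; split.
- rewrite (_ : (fun _ => _) = (fun X => complex.Re (f X))) //.
  by apply/funext => X; case: (f X).
- rewrite (_ : (fun _ => _) = (fun X => - complex.Im (f X))); last first.
    by apply/funext => X; case: (f X).
  exact: measurable_funN.
Qed.

Lemma cmeasurable_sum (I : Type) (r : seq I) (P : pred I) (f : I -> 'M[C]_n -> C) :
  (forall i, P i -> cmeasurable (f i)) ->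
  cmeasurable (fun X => \sum_(i <- r | P i) f i X).
Proof.
move=> mf; elim: r => [|a r IH].
  rewrite (_ : (fun _ => _) = (fun=> 0)); first exact: cmeasurable_cst.
  by apply/funext => X; rewrite big_nil.
rewrite (_ : (fun _ => _) = (fun X => if P a then f a X +
  \sum_(i <- r | P i) f i X else \sum_(i <- r | P i) f i X)); last first.
  by apply/funext => X; rewrite big_cons.
case Pa: (P a) => //.
exact: (cmeasurableD (mf a Pa) IH).
Qed.

Lemma cmeasurable_mul f (W : 'M[C]_n) : cmeasurable f -> cmeasurable (fun X =>
  f (W *m X)).
Proof.
by move=> [f1 f2]; split; [exact: measurableT_comp f1 (mul_measurable W)|exact:
  measurableT_comp f2 (mul_measurable W)].
Qed.

Lemma cmeasurable_eq0 f : cmeasurable f -> measurable ([set X | f X = 0] : set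
  (mxBorel R n)).
Proof.
move=> [f1 f2].
rewrite (_ : [set X | _] = (fun X => complex.Re (f X)) @^-1` [set 0] `&`
   (fun X => complex.Im (f X)) @^-1` [set 0]); last first.
  apply/seteqP; split => X /=; first by move=> ->.
  by case: (f X) => a b /= [-> ->].
by apply: measurableI; rewrite -[X in measurable X]setTI;
  [apply: f1|apply: f2].
Qed.

(** The group is cut out by finitely many polynomial equations in the entries
    and their conjugates. *)
Lemma measurable_stab (v : 'cV[C]_n) :
  measurable (stab_unitary v : set (mxBorel R n)).
Proof.
have -> : stab_unitary v =
  (\bigcap_(i in [set: 'I_n * 'I_n]) [set X : 'M[C]_n |
      \sum_k X i.1 k * (X i.2 k)^* - (i.1 == i.2)%:R = 0]) `&`
  (\bigcap_(i in [set: 'I_n]) [set X : 'M[C]_n |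
      \sum_k X i k * v k 0 - v i 0 = 0]).
  apply/seteqP; split => X /=.
    move=> [/unitarymxP XU Xv]; split.
      move=> [i j] _ /=; move/matrixP: XU => /(_ i j); rewrite !mxE => <-.
      by apply/eqP; rewrite subr_eq0; apply/eqP; apply: eq_bigr => k _; rewrite !mxE.
    move=> i _ /=; move/matrixP: Xv => /(_ i 0); rewrite !mxE => ->.
    by rewrite subrr.
  move=> [h1 h2]; split.
    apply/unitarymxP/matrixP => i j; rewrite !mxE.
    have /eqP := h1 (i, j) I; rewrite subr_eq0 => /eqP <-.
    by apply: eq_bigr => k _; rewrite !mxE.
  apply/matrixP => i j; rewrite !mxE ord1.
  by have /eqP := h2 i I; rewrite subr_eq0 => /eqP.
apply: measurableI; apply: fin_bigcap_measurable; try exact: finite_finset.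
- move=> ij _; apply: cmeasurable_eq0; apply: cmeasurableD; last exact: cmeasurable_cst.
  apply: cmeasurable_sum => k _; apply: cmeasurableM; first exact: cmeasurable_entry.
  by apply: cmeasurableJ; exact: cmeasurable_entry.
- move=> i _; apply: cmeasurable_eq0; apply: cmeasurableD; last exact: cmeasurable_cst.
  apply: cmeasurable_sum => k _; apply: cmeasurableM; first exact: cmeasurable_entry.
  exact: cmeasurable_cst.
Qed.
End Measurability.

(** * Expectation under Haar measure *)

Section InvariantMean.
Variables (R : realType) (n : nat) (v : 'cV[R[i]]_n).
Local Notation C := R[i].
Local Notation MX := 'M[C]_n.
Local Notation G := (stab_unitary v).

(** Boundedness is asked on the group only, where the random matrix lies almost
    surely. *)
Definition observable (h : MX -> C) :=
  cmeasurable h /\ exists c, forall X, G X -> normc (h X) <= c.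

(** All that is used of the Haar expectation.  The factor 2 in [mean_bound] pays
    for estimating the real and the imaginary part separately. *)
Record invariant_mean (E : (MX -> C) -> C) : Prop := InvariantMean {
  mean_lin : forall a f g, observable f -> observable g ->
    E (fun X => a * f X + g X) = a * E f + E g;
  mean_bound : forall f c, observable f ->
    (forall X, G X -> normc (f X) <= c) -> normc (E f) <= 2 * c;
  mean_cst : forall c, E (fun=> c) = c;
  mean_inv : forall W f, G W -> observable f -> E (fun X => f (W *m X)) = E f }.

End InvariantMean.

Section HaarMean.
Variables (R : realType) (n : nat) (v : 'cV[R[i]]_n).
Local Notation C := R[i].
Local Notation MX := 'M[C]_n.
Local Notation G := (stab_unitary v).
Variables (d : measure_display) (T : measurableType d) (Pr : probability T R)
  (U : {RV Pr >-> (mxBorel R n)}).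
Hypothesis haar : uniform_stab_unitary v U.

Let as_stab : {ae Pr, forall t, G (U t)}.
Proof.
have mG := @measurable_stab R n v.
exists (U @^-1` (~` G)); split => //.
  by rewrite -[X in measurable X]setTI; apply: measurable_funP => //; exact:
    measurableC.
have := @probability_setC _ _ _ (distribution Pr U) _ mG.
rewrite -[X in _ = X -> _]/(1 - distribution Pr U (stab_unitary v))%E.
by rewrite haar.1 -EFinB subrr.
Qed.

Let bounded_on (c : R) (f : mxBorel R n -> R) := forall X, G X -> `|f X| <= c.

Let intg (f : mxBorel R n -> R) c : measurable_fun setT f -> bounded_on c f ->
  Pr.-integrable setT (EFin \o (f \o U)).
Proof.
move=> mf bf.
have mfU : measurable_fun setT (EFin \o (f \o U)).
  by apply/measurable_EFinP; exact: measurableT_comp.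
apply/integrableP; split => //.
apply: le_lt_trans (_ : (`|c|%:E * Pr setT < +oo)%E); last first.
  by rewrite probability_setT mule1 ltry.
apply: integral_le_bound => //.
case: as_stab => N [mN N0 sN]; exists N; split => //.
move=> t /= ht; apply: sN => /= Gt; apply: ht => _.
by rewrite lee_fin; apply: le_trans (bf _ Gt) _; exact: ler_norm.
Qed.

Let rbound (f : mxBorel R n -> R) c : measurable_fun setT f -> bounded_on c f ->
  0 <= c -> `| fine (\int[Pr]_t (f (U t))%:E)%E | <= c.
Proof.
move=> mf bf c0; have fi := intg mf bf.
have fn := integrable_fin_num measurableT fi.
rewrite -lee_fin -abse_EFin fineK //.
apply: le_trans (le_abse_integral _ _ _) _ => //; first by case/integrableP: fi.
rewrite -[leRHS]mule1 -(@probability_setT _ _ _ Pr).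
apply: integral_le_bound => //; first by case/integrableP: fi.
case: as_stab => N [mN N0 sN]; exists N; split => //.
by move=> t /= ht; apply: sN => /= Gt; apply: ht => _; rewrite lee_fin; exact: bf.
Qed.

Let rinv (f : mxBorel R n -> R) c W : G W ->
  measurable_fun setT f -> bounded_on c f ->
  (\int[Pr]_t (f (W *m U t))%:E)%E = (\int[Pr]_t (f (U t))%:E)%E.
Proof.
move=> GW mf bf.
have mW := @mul_measurable R n W.
have mfW : measurable_fun setT (f \o (fun X : mxBorel R n => W *m X : mxBorel R n)).
  exact: measurableT_comp.
have WG X : G X -> G (W *m X).
  case: GW => W1 W2 [X1 X2]; split; first exact: mul_unitarymx.
  by rewrite -mulmxA X2.
have bfW : bounded_on c (f \o (fun X : mxBorel R n => W *m X : mxBorel R n)).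
  by move=> X /WG /bf.
have i1 := intg mfW bfW.
have i2 := intg mf bf.
rewrite -[LHS]/(\int[Pr]_t ((EFin \o f \o
  (fun X : mxBorel R n => W *m X : mxBorel R n)) \o U) t)%E.
rewrite -[RHS]/(\int[Pr]_t ((EFin \o f) \o U) t)%E.
rewrite -integral_distribution //; last exact/measurable_EFinP.
rewrite -integral_distribution //; last exact/measurable_EFinP.
have -> : (\int[distribution Pr U]_y (EFin \o f \o
    (fun X : mxBorel R n => W *m X : mxBorel R n)) y =
  \int[pushforward (distribution Pr U)
    (fun X : mxBorel R n => W *m X : mxBorel R n)]_y (EFin \o f) y)%E.
  have mEf : measurable_fun setT (EFin \o f) by exact/measurable_EFinP.
  have mEfW : measurable_fun setT (EFin \o (f \o
      (fun X : mxBorel R n => W *m X : mxBorel R n))) by exact/measurable_EFinP.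
  have mU : measurable_fun setT U by [].
  have iW := @integrable_pushforward _ _ _ _ _ _ mU Pr setT _ mEfW i1 measurableT.
  exact/esym/(@integral_pushforward _ _ _ _ _ _ mW (distribution Pr U) setT
    (EFin \o f) mEf iW measurableT).
apply: eq_measure_integral => A mA _; rewrite /pushforward /=.
case: GW => Wu Wv.
have WWs : W *m W^t* = 1%:M by apply/unitarymxP.
have WsW : W^t* *m W = 1%:M by apply: mulmx1C.
rewrite -(haar.2 (W^t*) A) //; last first.
  split; first by rewrite trmxC_unitary.
  by rewrite -{1}Wv mulmxA WsW mul1mx.
congr (distribution Pr U _); apply/seteqP; split => X /=.
  by move=> AX; exists (W *m X) => //; rewrite mulmxA WsW mul1mx.
by move=> [Y AY <-]; rewrite mulmxA WWs mul1mx.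
Qed.

Let normc_re (z : C) : `|complex.Re z| <= normc z.
Proof. by case: z => a b; rewrite /= -sqrtr_sqr ler_wsqrtr // lerDl sqr_ge0. Qed.
Let normc_im (z : C) : `|complex.Im z| <= normc z.
Proof. by case: z => a b; rewrite /= -sqrtr_sqr ler_wsqrtr // lerDr sqr_ge0. Qed.
Let normc_le (z : C) : normc z <= `|complex.Re z| + `|complex.Im z|.
Proof.
case: z => a b /=; rewrite -[leRHS]ger0_norm ?addr_ge0 // -sqrtr_sqr.
apply: ler_wsqrtr; rewrite sqrrD !real_normK ?num_real //.
have : 0 <= `|a| * `|b| by rewrite mulr_ge0.
by lra.
Qed.

Let lin_int (f g : mxBorel R n -> R) c e (a b : R) :
  measurable_fun setT f -> bounded_on c f ->
  measurable_fun setT g -> bounded_on e g ->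
  fine (\int[Pr]_t (a * f (U t) + b * g (U t))%R%:E)%E =
  a * fine (\int[Pr]_t (f (U t))%:E)%E + b * fine (\int[Pr]_t (g (U t))%:E)%E.
Proof.
move=> mf bf mg bg.
have fi := intg mf bf; have gi := intg mg bg.
have := @RintegralD _ _ _ Pr setT (fun t => a * f (U t)) (fun t => b * g (U t))
  measurableT.
rewrite /Rintegral => ->.
- have := @RintegralZl _ _ _ Pr setT _ a measurableT fi.
  have := @RintegralZl _ _ _ Pr setT _ b measurableT gi.
  by rewrite /Rintegral => -> ->.
- have := @integrableZl _ _ _ Pr setT measurableT a _ fi.
  by apply: eq_integrable => //.
- have := @integrableZl _ _ _ Pr setT measurableT b _ gi.
  by apply: eq_integrable => //.
Qed.

(** Invariance of the law on sets becomes invariance of integrals by pushing the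
    law forward along X |-> W X, whose preimages are the translates by W^-1. *)
Lemma haar_mean :
  invariant_mean v (fun h : MX -> C => cexpectation Pr (fun t => h (U t))).
Proof.
have obs (f : MX -> C) : observable v f -> exists c,
  [/\ measurable_fun setT (fun X : mxBorel R n => complex.Re (f X)),
      measurable_fun setT (fun X : mxBorel R n => complex.Im (f X)),
      bounded_on c (fun X : mxBorel R n => complex.Re (f X)) &
      bounded_on c (fun X : mxBorel R n => complex.Im (f X))].
  move=> [[m1 m2] [c bc]]; exists c; split => // X GX.
  - exact: le_trans (normc_re _) (bc _ GX).
  - exact: le_trans (normc_im _) (bc _ GX).
split.
- move=> a f g /obs[c [f1 f2 f3 f4]] /obs[e [g1 g2 g3 g4]].
  rewrite /cexpectation unlock.
  have afR := lin_int (complex.Re a) (- complex.Im a) f1 f3 f2 f4.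
  have afI := lin_int (complex.Im a) (complex.Re a) f1 f3 f2 f4.
  have mR := measurable_funD (measurable_funM (measurable_cst (complex.Re a)) f1)
    (measurable_funM (measurable_cst (- complex.Im a)) f2).
  have mI := measurable_funD (measurable_funM (measurable_cst (complex.Im a)) f1)
    (measurable_funM (measurable_cst (complex.Re a)) f2).
  pose c' := (`|complex.Re a| + `|complex.Im a|) * c.
  have bR : bounded_on c' (fun X : mxBorel R n => complex.Re a * complex.Re (f X)
     + - complex.Im a * complex.Im (f X)).
    move=> X GX; apply: le_trans (ler_normD _ _) _; rewrite !normrM normrN /c' mulrDl.
    by apply: lerD; apply: ler_wpM2l => //; [exact: f3|exact: f4].
  have bI : bounded_on c' (fun X : mxBorel R n => complex.Im a * complex.Re (f X)
     + complex.Re a * complex.Im (f X)).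
    move=> X GX; apply: le_trans (ler_normD _ _) _; rewrite !normrM /c' mulrDl addrC.
    by apply: lerD; apply: ler_wpM2l => //; [exact: f4|exact: f3].
  have sR := lin_int 1 1 mR bR g1 g3.
  have sI := lin_int 1 1 mI bI g2 g4.
  rewrite !mul1r afR in sR; rewrite !mul1r afI in sI.
  have eR : (fun t => (complex.Re (a * f (U t) + g (U t)))%:E) =
    (fun t => (1 * (complex.Re a * complex.Re (f (U t))
     + - complex.Im a * complex.Im (f (U t))) + 1 * complex.Re (g (U t)))%:E).
    apply/funext => t; rewrite !mul1r raddfD /=; congr (_ + _)%:E.
    by case: (a) (f (U t)) => [? ?] [? ?] /=; rewrite mulNr.
  have eI : (fun t => (complex.Im (a * f (U t) + g (U t)))%:E) =
    (fun t => (1 * (complex.Im a * complex.Re (f (U t))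
     + complex.Re a * complex.Im (f (U t))) + 1 * complex.Im (g (U t)))%:E).
    apply/funext => t; rewrite !mul1r raddfD /=; congr (_ + _)%:E.
    by case: (a) (f (U t)) => [? ?] [? ?] /=; rewrite addrC.
  rewrite eR eI sR sI; case: (a) => x y; apply/eqP; rewrite eq_complex /=.
  by rewrite mulNr !eqxx /= addrC [X in _ == X]addrC (addrC (x * _)) eqxx.
- move=> f c of_ bf.
  have [X0 GX0] : exists X, G X.
    exists 1%:M; split; last by rewrite mul1mx.
    by apply/unitarymxP; rewrite mul1mx trmx1 map_mx1.
  have c0 : 0 <= c by apply: le_trans (bf _ GX0); case: (f X0) => ? ?; exact: sqrtr_ge0.
  move: of_ => [[m1 m2] _].
  rewrite /cexpectation unlock; apply: le_trans (normc_le _) _; rewrite /=.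
  rewrite mulr_natl mulr2n; apply: lerD.
  - by apply: (rbound m1) => // X GX; apply: le_trans (normc_re _) (bf _ GX).
  - by apply: (rbound m2) => // X GX; apply: le_trans (normc_im _) (bf _ GX).
- by move=> [a b]; rewrite /cexpectation /= !expectation_cst.
- move=> W f GW /obs[c [f1 f2 f3 f4]]; rewrite /cexpectation unlock.
  by rewrite (rinv GW f1 f3) (rinv GW f2 f4).
Qed.

End HaarMean.

(** * Operator bounds *)

Section OperatorBounds.
Variables (R : realType) (n : nat).
Local Notation C := R[i].
Implicit Types (x y : 'cV[C]_n) (A B M : 'M[C]_n) (a b c : R).

Lemma normc_normE (z : C) : (normc z)%:C = `|z|. Proof. by []. Qed.

Lemma real_complexDE a b : (a + b)%:C = a%:C + b%:C.
Proof. exact: (rmorphD (real_complex R)). Qed.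

Lemma real_complexME a b : (a * b)%:C = a%:C * b%:C.
Proof. exact: (rmorphM (real_complex R)). Qed.

Lemma normc_ge0 (z : C) : 0 <= normc z.
Proof. by case: z => a b; exact: sqrtr_ge0. Qed.

Lemma normc_real a : normc (a%:C) = `|a|.
Proof. by rewrite /= expr0n addr0 sqrtr_sqr. Qed.

Lemma normc_nat k : normc (k%:R : C) = k%:R.
Proof.
have -> : (k%:R : C) = (k%:R : R)%:C by rewrite rmorph_nat.
by rewrite normc_real ger0_norm.
Qed.

Lemma le_normc_sum (I : Type) (r : seq I) (P : pred I) (f : I -> C) :
  normc (\sum_(i <- r | P i) f i) <= \sum_(i <- r | P i) normc (f i).
Proof.
elim/big_rec2: _ => [|i s t _ le]; first by rewrite normc0.
by apply: le_trans (le_normcD _ _) _; rewrite lerD2l.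
Qed.

Lemma l2norm_ge0 x : 0 <= l2norm x.
Proof. exact: sqrtr_ge0. Qed.

Lemma l2norm_sqr x : l2norm x ^+ 2 = \sum_j normc (x j 0) ^+ 2.
Proof. by rewrite /l2norm sqr_sqrtr // sumr_ge0 // => j _; exact: sqr_ge0. Qed.

Local Notation "''[' u , v ]" := (dotmx u v) : ring_scope.

Lemma dotmx_tr x y : '[x^T, y^T] = (y^t* *m x) 0 0.
Proof.
rewrite dotmxE !mxE; apply: eq_bigr => k _.
by rewrite !mxE mulrC.
Qed.

Lemma dotmx_l2norm x : '[x^T, x^T] = (l2norm x ^+ 2)%:C.
Proof.
rewrite dotmx_tr mxE l2norm_sqr rmorph_sum; apply: eq_bigr => k _.
by rewrite !mxE rmorphXn /= normc_normE normCKC.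
Qed.

Lemma sqrtC_l2norm x : sqrtC '[x^T, x^T] = (l2norm x)%:C.
Proof. by rewrite dotmx_l2norm rmorphXn /= sqrCK // lecR l2norm_ge0. Qed.

Lemma normc_dot_le x y : normc ((x^t* *m y) 0 0) <= l2norm x * l2norm y.
Proof.
have : `|'[y^T, x^T]| <= sqrtC '[y^T, y^T] * sqrtC '[x^T, x^T].
  exact: (CauchySchwarz_sqrt (@dotmx C n) y^T x^T).1.
rewrite (sqrtC_l2norm y) (sqrtC_l2norm x) dotmx_tr -normc_normE  -real_complexME.
by rewrite mulrC lecR.
Qed.

Lemma l2normD x y : l2norm (x + y) <= l2norm x + l2norm y.
Proof.
have : sqrtC '[x^T + y^T, x^T + y^T] <= sqrtC '[x^T, x^T] + sqrtC '[y^T, y^T].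
  exact: (triangle_lerif (@dotmx C n) x^T y^T).1.
have <- : (x + y)^T = x^T + y^T by rewrite [LHS]linearD.
rewrite (sqrtC_l2norm (x + y)) (sqrtC_l2norm x) (sqrtC_l2norm y).
by rewrite -real_complexDE lecR.
Qed.

Lemma l2normZ (z : C) x : l2norm (z *: x) = normc z * l2norm x.
Proof.
rewrite /l2norm -[normc z](@ger0_norm R) ?normc_ge0 // -sqrtr_sqr -sqrtrM ?sqr_ge0 //.
by rewrite mulr_sumr; congr Num.sqrt; apply: eq_bigr => j _; rewrite mxE normcM exprMn.
Qed.

Lemma l2norm_unitary (U : 'M[C]_n) x : U \is unitarymx -> l2norm (U *m x) = l2norm x.
Proof.
move=> UU; have UsU : U^t* *m U = 1%:M by apply: mulmx1C; exact/unitarymxP.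
apply/eqP; rewrite -(@eqrXn2 _ 2) ?l2norm_ge0 //; apply/eqP.
have : (l2norm (U *m x) ^+ 2)%:C = (l2norm x ^+ 2)%:C.
  rewrite -!dotmx_l2norm !dotmx_tr trmx_mul map_mxM mulmxA -(mulmxA _ _ U).
  by rewrite UsU mulmx1.
by case.
Qed.

Lemma normc_entry_le x j : normc (x j 0) <= l2norm x.
Proof.
rewrite -[leLHS](@ger0_norm R) ?normc_ge0 // -sqrtr_sqr; apply: ler_wsqrtr.
by rewrite (bigD1 j) //= lerDl sumr_ge0 // => k _; exact: sqr_ge0.
Qed.

Lemma l2norm_delta j : l2norm (delta_mx j 0 : 'cV[C]_n) = 1.
Proof.
apply/eqP; rewrite -(@eqrXn2 _ 2) ?l2norm_ge0 ?ler01 // l2norm_sqr expr1n.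
rewrite (bigD1 j) //= mxE !eqxx normc1 expr1n big1 ?addr0 // => k kj.
by rewrite mxE (negPf kj) normc0 expr0n.
Qed.

(** A bound on the operator norm stands in for its value, so that products and
    sums are estimated without taking suprema. *)
Definition opbnd M c := forall x, l2norm (M *m x) <= c * l2norm x.

Lemma opbndM A B a b : 0 <= a -> opbnd A a -> opbnd B b -> opbnd (A *m B) (a * b).
Proof.
move=> a0 hA hB x; rewrite -mulmxA; apply: le_trans (hA _) _.
by rewrite -mulrA ler_wpM2l.
Qed.

Lemma opbndD A B a b : opbnd A a -> opbnd B b -> opbnd (A + B) (a + b).
Proof.
move=> hA hB x; rewrite mulmxDl; apply: le_trans (l2normD _ _) _.
by rewrite mulrDl lerD.
Qed.

Lemma opbndZ A a (z : C) : opbnd A a -> opbnd (z *: A) (normc z * a).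
Proof.
by move=> hA x; rewrite -scalemxAl l2normZ -mulrA ler_wpM2l ?normc_ge0.
Qed.

Lemma opbndN A a : opbnd A a -> opbnd (- A) a.
Proof.
move=> hA; rewrite -scaleN1r -[a]mul1r -[X in X * a](@normc1 R) -(normcN 1).
exact: opbndZ.
Qed.

Lemma opbnd1 : opbnd 1%:M 1.
Proof. by move=> x; rewrite mul1mx mul1r. Qed.

Lemma opbnd0 : opbnd 0 0.
Proof. by move=> x; rewrite mul0mx mul0r -(scale0r (0 : 'cV_n)) l2normZ normc0
  mul0r. Qed.

Lemma opbnd_unitary (U : 'M[C]_n) : U \is unitarymx -> opbnd U 1.
Proof. by move=> UU x; rewrite l2norm_unitary // mul1r. Qed.

Lemma opbnd_le M a b : a <= b -> opbnd M a -> opbnd M b.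
Proof. by move=> ab hM x; apply: le_trans (hM x) _; rewrite ler_wpM2r ?l2norm_ge0. Qed.

Lemma opbnd_conj (U : 'M[C]_n) A a : 0 <= a -> U \is unitarymx -> opbnd A a ->
  opbnd (U *m A *m U^t*) a.
Proof.
move=> a0 UU hA; rewrite -[a]mulr1 -[a]mul1r; apply: opbndM; first by rewrite mul1r.
  by apply: opbndM => //; exact: opbnd_unitary.
by apply: opbnd_unitary; rewrite trmxC_unitary.
Qed.

Lemma normc_entry_opbnd M c i j : opbnd M c -> normc (M i j) <= c.
Proof.
move=> hM; have := hM (delta_mx j 0); rewrite l2norm_delta mulr1; apply: le_trans.
have -> : M i j = (M *m (delta_mx j 0 : 'cV_n)) i 0 by rewrite -colE mxE.
exact: normc_entry_le.
Qed.

Lemma normc_tr_opbnd M c : opbnd M c -> normc (\tr M) <= n%:R * c.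
Proof.
move=> hM; apply: le_trans (le_normc_sum _ _ _) _.
apply: le_trans (_ : \sum_(i < n) c <= _).
  by apply: ler_sum => i _; exact: normc_entry_opbnd.
by rewrite sumr_const card_ord mulr_natl.
Qed.

Lemma vector_state_trE (v : 'cV[C]_n) M : \tr (v *m v^t* *m M) = (v^t* *m (M *m v)) 0 0.
Proof. by rewrite -mulmxA mxtrace_mulC trace_mx11 mulmxA. Qed.

Lemma normc_vector_state_opbnd (v : 'cV[C]_n) M c : l2norm v = 1 -> opbnd M c ->
  normc (\tr (v *m v^t* *m M)) <= c.
Proof.
move=> v1 hM; rewrite vector_state_trE; apply: le_trans (normc_dot_le _ _) _.
by rewrite v1 mul1r; apply: le_trans (hM _) _; rewrite v1 mulr1.
Qed.

Section Projections.
Variable v : 'cV[C]_n.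
Hypothesis v1 : l2norm v = 1.

Lemma unit_dot : v^t* *m v = 1%:M.
Proof.
apply/matrixP => i j; rewrite !ord1 [RHS]mxE /=.
by rewrite -dotmx_tr dotmx_l2norm v1 expr1n.
Qed.

Lemma opbnd_proj : opbnd (v *m v^t*) 1.
Proof.
move=> x; have -> : v *m v^t* *m x = (v^t* *m x) 0 0 *: v.
  rewrite -mulmxA; move: (v^t* *m x) => w; apply/matrixP => i j.
  by rewrite ord1 !mxE big_ord1 mulrC.
rewrite l2normZ v1 mulr1 mul1r; apply: le_trans (normc_dot_le _ _) _.
by rewrite v1 mul1r.
Qed.

(** Pythagoras: |x|^2 = |Q x|^2 + |p x|^2 for p = v v* and Q = 1 - p. *)
Lemma opbnd_compl : opbnd (1%:M - v *m v^t*) 1.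
Proof.
move=> x; rewrite mul1r; set p := v *m v^t*.
have pp : p *m p = p by rewrite /p mulmxA -(mulmxA v) unit_dot mulmx1.
have ph : p^t* = p by rewrite /p trmx_mul map_mxM trmxCK.
have qh : (1%:M - p)^t* = 1%:M - p.
  by rewrite linearB /= map_mxB trmx1 map_mx1 ph.
have qq : (1%:M - p) *m (1%:M - p) = 1%:M - p.
  by rewrite mulmxBr mulmx1 mulmxBl mul1mx pp subrr subr0.
clearbody p; rewrite -(@ler_pXn2r _ 2) ?nnegrE ?l2norm_ge0 //.
have : (l2norm x ^+ 2)%:C =
    (l2norm ((1%:M - p) *m x) ^+ 2 + l2norm (p *m x) ^+ 2)%:C.
  rewrite real_complexDE -(dotmx_l2norm x) -(dotmx_l2norm (p *m x)).
  rewrite -(dotmx_l2norm ((1%:M - p) *m x)) !dotmx_tr !trmx_mul !map_mxM.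
  rewrite qh ph !mulmxA -(mulmxA _ (1%:M - p) (1%:M - p)) qq -(mulmxA _ p p) pp.
  have e : x^t* *m x = x^t* *m (1%:M - p) *m x + x^t* *m p *m x.
    by rewrite -mulmxDl -mulmxDr subrK mulmx1.
  by rewrite {1}e mxE.
by case => ->; rewrite lerDl sqr_ge0.
Qed.
End Projections.

(** The supremum defining [opnorm] is over a bounded set, each coordinate of
    M x being at most the sum of the moduli of the entries of its row; then
    rescale x to the unit sphere. *)
Lemma opnorm_opbnd M (r : R) : opnorm M <= r -> opbnd M r.
Proof.
move=> hM x.
pose S := [set l2norm (M *m x) | x in [set x : 'cV[C]_n | l2norm x <= 1]].
have ub : has_ubound S.
  exists (Num.sqrt (\sum_(i < n) (\sum_(j < n) normc (M i j)) ^+ 2)).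
  move=> _ [y /= y1 <-]; apply: ler_wsqrtr; apply: ler_sum => i _.
  rewrite ler_pXn2r ?nnegrE ?normc_ge0 ?sumr_ge0 // => [|j _]; last exact: normc_ge0.
  rewrite mxE; apply: le_trans (le_normc_sum _ _ _) _; apply: ler_sum => j _.
  rewrite normcM ler_piMr ?normc_ge0 //.
  exact: le_trans (normc_entry_le _ _) y1.
have [x0|x0] := eqVneq (l2norm x) 0.
  have -> : x = 0.
    apply/matrixP => i j; rewrite ord1 mxE; apply: eq0_normc; apply/eqP.
    by rewrite eq_le normc_ge0 andbT -x0 normc_entry_le.
  by rewrite mulmx0 -(scale0r (0 : 'cV_n)) l2normZ normc0 mul0r mulr0.
have xp : 0 < l2norm x by rewrite lt_def x0 l2norm_ge0.
pose y := ((l2norm x)^-1)%:C *: x.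
have y1 : l2norm y = 1.
  by rewrite /y l2normZ normc_real ger0_norm ?invr_ge0 ?l2norm_ge0 // mulVf.
have : l2norm (M *m y) <= r.
  by apply: le_trans hM; apply: ub_le_sup => //; exists y => //=; rewrite y1.
rewrite /y -scalemxAr l2normZ normc_real ger0_norm ?invr_ge0 ?l2norm_ge0 //.
by rewrite mulrC ler_pdivrMr.
Qed.

End OperatorBounds.

(** * Calculus along rotations fixing a vector *)

Section Observables.
Variables (R : realType) (n : nat) (v : 'cV[R[i]]_n).
Local Notation C := R[i].
Local Notation MX := 'M[C]_n.
Local Notation G := (stab_unitary v).
Implicit Types (f g : MX -> C) (F H : MX -> MX) (X W : MX).

Lemma stab_mul W X : G W -> G X -> G (W *m X).
Proof.
move=> [W1 W2] [X1 X2]; split; first exact: mul_unitarymx.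
by rewrite -mulmxA X2.
Qed.

Lemma observable_cst c : observable v (fun=> c).
Proof. by split; [exact: cmeasurable_cst|exists (normc c)]. Qed.

Lemma observableD f g : observable v f -> observable v g ->
  observable v (fun X => f X + g X).
Proof.
move=> [mf [a fa]] [mg [b gb]]; split; first exact: cmeasurableD.
exists (a + b) => X GX; apply: le_trans (le_normcD _ _) _.
by apply: lerD; [exact: fa|exact: gb].
Qed.

Lemma observableM f g : observable v f -> observable v g ->
  observable v (fun X => f X * g X).
Proof.
move=> [mf [a fa]] [mg [b gb]]; split; first exact: cmeasurableM.
exists (a * b) => X GX; rewrite normcM.
by apply: ler_pM; rewrite ?normc_ge0 //; [exact: fa|exact: gb].
Qed.

Lemma observableZ (c : C) f : observable v f -> observable v (fun X => c * f X).
Proof. by move=> of_; exact: (observableM (observable_cst c) of_). Qed.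

Lemma observableN f : observable v f -> observable v (fun X => - f X).
Proof.
move=> of_; rewrite (_ : (fun _ => _) = (fun X => -1 * f X)); first exact: observableZ.
by apply/funext => X; rewrite mulN1r.
Qed.

Lemma observableB f g : observable v f -> observable v g ->
  observable v (fun X => f X - g X).
Proof. by move=> of_ og; exact: (observableD of_ (observableN og)). Qed.

Lemma normc_conj (z : C) : normc z^* = normc z.
Proof. by case: z => a b /=; rewrite sqrrN. Qed.

Lemma observableJ f : observable v f -> observable v (fun X => (f X)^*).
Proof.
move=> [mf [a fa]]; split; first exact: cmeasurableJ.
by exists a => X GX; rewrite normc_conj; exact: fa.
Qed.

Lemma observable_sum (I : Type) (r : seq I) (f : I -> MX -> C) :
  (forall i, observable v (f i)) -> observable v (fun X => \sum_(i <- r) f i X).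
Proof.
move=> of_; elim: r => [|a r IH].
  rewrite (_ : (fun _ => _) = (fun=> 0)); first exact: observable_cst.
  by apply/funext => X; rewrite big_nil.
rewrite (_ : (fun _ => _) = (fun X => f a X + \sum_(i <- r) f i X)).
  exact: (observableD (of_ a) IH).
by apply/funext => X; rewrite big_cons.
Qed.

Lemma observable_transl W f : G W -> observable v f ->
  observable v (fun X => f (W *m X)).
Proof.
move=> GW [mf [a fa]]; split; first exact: cmeasurable_mul.
by exists a => X GX; apply: fa; exact: stab_mul.
Qed.

Definition mx_observable F := forall i j, observable v (fun X => F X i j).

Lemma mx_observable_cst M : mx_observable (fun=> M).
Proof. by move=> i j; exact: observable_cst. Qed.

Lemma mx_observable_id : mx_observable id.
Proof.
move=> i j; split; first exact: cmeasurable_entry.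
by exists 1 => X [XU _]; apply: normc_entry_opbnd; exact: opbnd_unitary.
Qed.

Lemma mx_observableM F H : mx_observable F -> mx_observable H ->
  mx_observable (fun X => F X *m H X).
Proof.
move=> oF oH i j.
rewrite (_ : (fun _ => _) = (fun X => \sum_k F X i k * H X k j)); last first.
  by apply/funext => X; rewrite mxE.
by apply: observable_sum => k; exact: (observableM (oF i k) (oH k j)).
Qed.

Lemma mx_observableD F H : mx_observable F -> mx_observable H ->
  mx_observable (fun X => F X + H X).
Proof.
move=> oF oH i j.
rewrite (_ : (fun _ => _) = (fun X => F X i j + H X i j)); last first.
  by apply/funext => X; rewrite mxE.
exact: (observableD (oF i j) (oH i j)).
Qed.

Lemma mx_observableZ f F : observable v f -> mx_observable F ->
  mx_observable (fun X => f X *: F X).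
Proof.
move=> of_ oF i j.
rewrite (_ : (fun _ => _) = (fun X => f X * F X i j)); last first.
  by apply/funext => X; rewrite mxE.
exact: (observableM of_ (oF i j)).
Qed.

Lemma mx_observableN F : mx_observable F -> mx_observable (fun X => - F X).
Proof.
move=> oF i j; rewrite (_ : (fun _ => _) = (fun X => - F X i j)); last first.
  by apply/funext => X; rewrite mxE.
exact: observableN.
Qed.

Lemma mx_observable_adj F : mx_observable F -> mx_observable (fun X => (F X)^t*).
Proof.
move=> oF i j.
rewrite (_ : (fun _ => _) = (fun X => (F X j i)^*)); first exact: observableJ.
by apply/funext => X; rewrite !mxE.
Qed.

Lemma observable_tr F : mx_observable F -> observable v (fun X => \tr (F X)).
Proof. by move=> oF; apply: observable_sum => i; exact: oF. Qed.

Section Tangent.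
Variable u : 'cV[C]_n.

Let s := l2norm u ^+ 2.
Let P := u *m u^t*.
Let ii : C := Complex 0 1.
Let delta (e : R) : C := Complex 1 (- (e * s / 2)).
Let alpha (e : R) : C := ii * e%:C / delta e.

(** A curve in the group with velocity i u u* at e = 0.  The coefficient alpha is
    i e to first order and satisfies alpha + conj(alpha) + s |alpha|^2 = 0 with
    s = |u|^2, which makes 1 + alpha u u* exactly unitary without any
    exponential. *)
Definition rotation (e : R) : MX := 1%:M + alpha e *: P.

Let delta_neq0 e : delta e != 0.
Proof. by apply/eqP => -[/eqP]; rewrite oner_eq0. Qed.

Let delta_ge1 e : 1 <= normc (delta e).
Proof.
rewrite /= -[X in X <= _]sqrtr1 expr1n; apply: ler_wsqrtr.
by rewrite lerDl sqr_ge0.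
Qed.

Let PP : P *m P = s%:C *: P.
Proof.
rewrite /P mulmxA -(mulmxA u) [u^t* *m u]mx11_scalar -dotmx_tr dotmx_l2norm.
by rewrite mul_mx_scalar scalemxAl.
Qed.

Let Ph : P^t* = P.
Proof. by rewrite /P trmx_mul map_mxM trmxCK. Qed.

Lemma stab_rotation e : u^t* *m v = 0 -> G (rotation e).
Proof.
move=> uv; split; last first.
  by rewrite /rotation mulmxDl mul1mx -scalemxAl /P -mulmxA uv mulmx0 scaler0 addr0.
apply/unitarymxP.
have -> : (rotation e)^t* = 1%:M + (alpha e)^* *: P.
  by rewrite /rotation linearD /= map_mxD linearZ /= map_mxZ trmx1 map_mx1 Ph.
rewrite /rotation mulmxDl mul1mx mulmxDr mulmx1 -scalemxAl -scalemxAr PP.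
rewrite -addrA !scalerA -!scalerDl.
suff -> : (alpha e)^* + (alpha e + alpha e * (alpha e)^* * s%:C) = 0.
  by rewrite scale0r addr0.
have dj0 : (delta e)^* != 0 by rewrite conjC_eq0.
have -> : (alpha e)^* = - (ii * e%:C) / (delta e)^*.
  rewrite /alpha rmorphM fmorphV rmorphM; congr (_ / _).
  by apply/eqP; rewrite eq_complex /=; apply/andP; split; apply/eqP; ring.
have dd : (delta e)^* = delta e + ii * e%:C * s%:C.
  by apply/eqP; rewrite eq_complex /=; apply/andP; split; apply/eqP; field.
rewrite /alpha; move: (delta_neq0 e) dj0; rewrite dd.
move: (delta e) (ii * e%:C) (s%:C) => x y z x0 xyz0.
by field; rewrite x0 xyz0.
Qed.

Lemma rotation_expansion e : 0 <= e ->
  normc (alpha e - ii * e%:C) <= s * e ^+ 2.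
Proof.
move=> e0; have -> : alpha e - ii * e%:C = (- (s / 2 * e ^+ 2))%:C / delta e.
  rewrite /alpha; apply: (mulIf (delta_neq0 e)); rewrite mulrBl !divfK ?delta_neq0 //.
  by apply/eqP; rewrite eq_complex /=; apply/andP; split; apply/eqP; field.
have s0 : 0 <= s by exact: sqr_ge0.
have s2 : 0 <= s / 2 * e ^+ 2 by apply: mulr_ge0; [exact: divr_ge0|exact: sqr_ge0].
rewrite normcM normcV normc_real normrN (ger0_norm s2).
rewrite ler_pdivrMr; last exact: lt_le_trans ltr01 (delta_ge1 e).
have h : 0 <= s * e ^+ 2 by apply: mulr_ge0 => //; exact: sqr_ge0.
apply: le_trans (_ : s * e ^+ 2 * 1 <= _); last by rewrite ler_wpM2l.
by rewrite mulrAC mulr1; move: (s * e ^+ 2) h => z h; lra.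
Qed.

(** The derivative of f along the rotations is i f': the factor i is taken out so
    that words have derivatives that are polynomials in u u*.  The remainder is
    uniform on the group and so survives integration. *)
Definition tangent f f' := exists K : R, forall e X, 0 <= e <= 1 -> G X ->
  normc (f (rotation e *m X) - f X - ii * e%:C * f' X) <= K * e ^+ 2.

Lemma tangent_cst c : tangent (fun=> c) (fun=> 0).
Proof.
by exists 0 => e X _ _; rewrite subrr mulr0 subr0 normc0 mul0r.
Qed.

Lemma tangentD f f' g g' : tangent f f' -> tangent g g' ->
  tangent (fun X => f X + g X) (fun X => f' X + g' X).
Proof.
move=> [K hK] [L hL]; exists (K + L) => e X he GX; rewrite mulrDl.
apply: le_trans (lerD (hK e X he GX) (hL e X he GX)).
apply: le_trans (le_normcD _ _); rewrite le_eqVlt; apply/orP; left; apply/eqP.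
by congr normc; ring.
Qed.

Let normc_ii e : 0 <= e -> normc (ii * e%:C) = e.
Proof.
by move=> e0; rewrite normcM normc_real ger0_norm //= expr0n add0r expr1n sqrtr1 mul1r.
Qed.

Lemma tangentM f f' g g' : u^t* *m v = 0 ->
  observable v f -> observable v f' -> observable v g -> observable v g' ->
  tangent f f' -> tangent g g' ->
  tangent (fun X => f X * g X) (fun X => f' X * g X + f X * g' X).
Proof.
move=> uv [_ [a fa]] [_ [a' fa']] [_ [b gb]] [_ [b' gb']] [K hK] [L hL].
exists (K * b + a * L + a' * L + a' * b') => e X /[dup] he /andP[e0 e1] GX.
have GrX : G (rotation e *m X) by apply: stab_mul => //; exact: stab_rotation.
set t := ii * e%:C.
have -> : f (rotation e *m X) * g (rotation e *m X) - f X * g X -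
    t * (f' X * g X + f X * g' X) =
    (f (rotation e *m X) - f X - t * f' X) * g (rotation e *m X) +
    f X * (g (rotation e *m X) - g X - t * g' X) +
    t * f' X * (g (rotation e *m X) - g X - t * g' X) +
    t * t * (f' X * g' X) by ring.
have e2 : 0 <= e ^+ 2 by exact: sqr_ge0.
rewrite [leRHS]mulrDl [X in X + _ * _ ^+ _]mulrDl [X in X + _ * _ ^+ _ + _]mulrDl.
refine (le_trans (le_normcD _ _) (lerD (le_trans (le_normcD _ _) (lerD
  (le_trans (le_normcD _ _) (lerD _ _)) _)) _)).
- rewrite normcM [leRHS]mulrAC; apply: ler_pM; rewrite ?normc_ge0 //.
  + exact: hK.
  + exact: gb.
- rewrite normcM -[leRHS]mulrA; apply: ler_pM; rewrite ?normc_ge0 //.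
  + exact: fa.
  + exact: hL.
- rewrite (normcM (t * _)) (normcM t) normc_ii // -[leLHS]mulrA; apply:
  le_trans (_ : 1 * (normc (f' X) *
     normc (g (rotation e *m X) - g X - t * g' X)) <= _).
    by apply: ler_wpM2r => //; rewrite mulr_ge0 ?normc_ge0.
  rewrite mul1r -[leRHS]mulrA; apply: ler_pM; rewrite ?normc_ge0 //.
  + exact: fa'.
  + exact: hL.
- rewrite (normcM (t * t)) (normcM t) (normcM (f' X)) normc_ii //.
  rewrite [leLHS]mulrC -expr2; apply: ler_wpM2r => //.
  apply: ler_pM; rewrite ?normc_ge0 //.
  + exact: fa'.
  + exact: gb'.
Qed.

Lemma tangent_eq f f' g g' : f =1 g -> f' =1 g' -> tangent f f' -> tangent g g'.
Proof. by move=> /funext -> /funext ->. Qed.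

Lemma tangent_sum (I : Type) (r : seq I) (f f' : I -> MX -> C) :
  (forall i, tangent (f i) (f' i)) ->
  tangent (fun X => \sum_(i <- r) f i X) (fun X => \sum_(i <- r) f' i X).
Proof.
move=> tf; elim: r => [|a r IH].
  by apply: tangent_eq (tangent_cst 0) => X; rewrite big_nil.
by apply: tangent_eq (tangentD (tf a) IH) => X; rewrite big_cons.
Qed.

Lemma tangentJ f f' : tangent f f' ->
  tangent (fun X => (f X)^*) (fun X => - (f' X)^*).
Proof.
move=> [K hK]; exists K => e X he GX.
have -> : (f (rotation e *m X))^* - (f X)^* - ii * e%:C * - (f' X)^* =
   (f (rotation e *m X) - f X - ii * e%:C * f' X)^*.
  rewrite !rmorphB rmorphM; congr (_ - _ - _).
  by rewrite mulrN -mulNr; congr (_ * _); apply/eqP; rewrite eq_complex /=;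
    apply/andP; split; apply/eqP; ring.
by rewrite normc_conj; exact: hK.
Qed.

Definition mx_tangent F F' :=
  forall i j, tangent (fun X => F X i j) (fun X => F' X i j).

Lemma mx_tangent_cst M : mx_tangent (fun=> M) (fun=> 0).
Proof. by move=> i j; apply: tangent_eq (tangent_cst (M i j)) => X //; rewrite mxE. Qed.

Lemma mx_tangent_id : mx_tangent id (fun X => P *m X).
Proof.
move=> i j; have [_ [c hc]] := mx_observableM (mx_observable_cst P)
  mx_observable_id i j.
exists (s * c) => e X /andP[e0 e1] GX /=.
have -> : (rotation e *m X) i j - X i j - ii * e%:C * (P *m X) i j =
    (alpha e - ii * e%:C) * (P *m X) i j.
  rewrite /rotation mulmxDl mul1mx -scalemxAl; move: (P *m X) => Y.
  by rewrite !mxE; ring.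
by rewrite normcM mulrAC; apply: ler_pM; rewrite ?normc_ge0 //;
  [exact: rotation_expansion|exact: hc].
Qed.

Lemma mx_tangentM F F' H H' : u^t* *m v = 0 ->
  mx_observable F -> mx_observable F' -> mx_observable H -> mx_observable H' ->
  mx_tangent F F' -> mx_tangent H H' ->
  mx_tangent (fun X => F X *m H X) (fun X => F' X *m H X + F X *m H' X).
Proof.
move=> uv oF oF' oH oH' tF tH i j.
have := tangent_sum (index_enum 'I_n)
  (fun k => tangentM uv (oF i k) (oF' i k) (oH k j) (oH' k j) (tF i k) (tH k j)).
apply: tangent_eq => X; first by rewrite mxE.
by rewrite big_split /= !mxE.
Qed.

Lemma mx_tangent_adj F F' : mx_tangent F F' ->
  mx_tangent (fun X => (F X)^t*) (fun X => - (F' X)^t*).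
Proof.
by move=> tF i j; apply: tangent_eq (tangentJ (tF j i)) => X; rewrite !mxE.
Qed.

Lemma tangent_tr F F' : mx_tangent F F' ->
  tangent (fun X => \tr (F X)) (fun X => \tr (F' X)).
Proof. by move=> tF; apply: tangent_sum => i; exact: tF. Qed.

(** By invariance f (W X) - f X has mean zero, hence e |E f'| is at most a
    constant times e^2 for all small e. *)
Lemma mean_tangent (E : (MX -> C) -> C) f f' : u^t* *m v = 0 ->
  invariant_mean v E -> observable v f -> observable v f' -> tangent f f' ->
  E f' = 0.
Proof.
move=> uv [Elin Ebnd _ Einv] of_ of' [K hK].
have step e : 0 < e -> e <= 1 -> normc (E f') <= 2 * K * e.
  move=> e0 e1; have Gr := @stab_rotation e uv.
  have of_r := observable_transl Gr of_.
  have t0 : ii * e%:C != 0.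
    by apply/eqP => h; have := normc_ii (ltW e0); rewrite h normc0 => e0';
      rewrite -e0' ltxx in e0.
  pose g X := (- (ii * e%:C)) * f' X + (-1 * f X + f (rotation e *m X)).
  have og : observable v g.
    by apply: observableD; [exact: observableZ|apply: observableD => //; exact:
      observableZ].
  have Eg : E g = - (ii * e%:C) * E f'.
    rewrite /g Elin //; last by apply: observableD => //; exact: observableZ.
    by rewrite Elin // Einv // mulN1r addNr addr0.
  have : normc (E g) <= 2 * (K * e ^+ 2).
    apply: Ebnd => // X GX; rewrite /g.
    have -> : - (ii * e%:C) * f' X + (-1 * f X + f (rotation e *m X)) =
      f (rotation e *m X) - f X - ii * e%:C * f' X by ring.
    by apply: hK => //; rewrite (ltW e0).
  rewrite Eg normcM normcN normc_ii ?(ltW e0) //.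
  have -> : 2 * (K * e ^+ 2) = e * (2 * K * e) by ring.
  by rewrite ler_pM2l.
apply: eq0_normc; apply/eqP; rewrite eq_le normc_ge0 andbT leNgt; apply/negP => p.
have K0 : 0 <= K.
  have := step 1 ltr01 (lexx 1); rewrite mulr1 => h.
  by have := le_trans (ltW p) h; rewrite pmulr_rge0.
pose e := Num.min 1 (normc (E f') / (4 * K + 4)).
have q0 : 0 < 4 * K + 4 by lra.
have e0 : 0 < e by rewrite lt_min ltr01 divr_gt0.
have e1 : e <= 1 by rewrite ge_min lexx.
have := step e e0 e1; rewrite leNgt => /negP; apply.
have le : e <= normc (E f') / (4 * K + 4) by rewrite ge_min lexx orbT.
have : e * (4 * K + 4) <= normc (E f') by rewrite -ler_pdivlMr.
by nra.
Qed.

End Tangent.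
End Observables.

(** * Words in deterministic and conjugated matrices *)

Section Words.
Variables (R : realType) (n : nat) (v : 'cV[R[i]]_n).
Hypothesis v1 : l2norm v = 1.
Local Notation C := R[i].
Local Notation MX := 'M[C]_n.
Local Notation G := (stab_unitary v).
Implicit Types (X Y Z P : MX) (l : bool * MX) (w : seq (bool * MX)).
Implicit Types (u x y : 'cV[C]_n).

Definition eval_letter X l : MX := if l.1 then X *m l.2 *m X^t* else l.2.
Definition eval_word X w : MX := foldr (fun l M => eval_letter X l *m M) 1%:M w.
Definition deriv_letter P X l : MX := if l.1 then P *m eval_letter X l -
  eval_letter X l *m P else 0.
(** The derivation P c - c P of conjugated letters is what the rotation generated
    by P = u u* induces, up to the factor i of [tangent]. *)
Fixpoint deriv_word P X w : MX :=
  if w is l :: w' then deriv_letter P X l *m eval_word X w' + eval_letter X l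
    *m deriv_word P X w' else 0.
(** The matrix that represents P |-> tr (Z D_P w) by [tr_deriv_word]. *)
Fixpoint word_gradient X Z w : MX :=
  if w is l :: w' then
    (if l.1 then eval_letter X l *m eval_word X w' *m Z - eval_word X w' *m Z
      *m eval_letter X l else 0)
    + word_gradient X (Z *m eval_letter X l) w'
  else 0.

Definition contractive w := forall l, l \in w -> opbnd l.2 1.

Lemma contractive_cons l w : contractive (l :: w) <-> opbnd l.2 1 /\ contractive w.
Proof.
split=> [h|[h1 h2] m]; first by split=> [|m mw]; apply: h; rewrite inE ?eqxx ?mw ?orbT.
by rewrite inE => /orP[/eqP->//|/h2].
Qed.

Lemma contractive_cat w1 w2 : contractive (w1 ++ w2) <-> contractive w1 /\
  contractive w2.
Proof.
split=> [h|[h1 h2] m]; first by split=> m mw; apply: h; rewrite mem_cat mw ?orbT.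
by rewrite mem_cat => /orP[/h1|/h2].
Qed.

Lemma eval_word_cat X w1 w2 : eval_word X (w1 ++ w2) = eval_word X w1 *m eval_word X w2.
Proof. by elim: w1 => [|l w IH] /=; rewrite ?mul1mx // IH mulmxA. Qed.

Lemma opbnd_eval_letter X l : G X -> opbnd l.2 1 -> opbnd (eval_letter X l) 1.
Proof. by move=> [XU _] hl; rewrite /eval_letter; case: ifP => // _; exact:
  opbnd_conj. Qed.

Lemma opbnd_eval_word X w : G X -> contractive w -> opbnd (eval_word X w) 1.
Proof.
move=> GX; elim: w => [_|l w IH] /=; first exact: opbnd1.
move=> /contractive_cons[hl /IH hw]; rewrite -[1]mulr1.
by apply: opbndM => //; exact: opbnd_eval_letter.
Qed.

Lemma mx_observable_eval_letter l : mx_observable v (fun X => eval_letter X l).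
Proof.
rewrite /eval_letter; case: (l.1); last exact: mx_observable_cst.
apply: mx_observableM; last exact/mx_observable_adj/mx_observable_id.
by apply: mx_observableM; [exact: mx_observable_id|exact: mx_observable_cst].
Qed.

Lemma mx_observable_eval_word w : mx_observable v (fun X => eval_word X w).
Proof.
elim: w => [|l w IH] /=; first exact: mx_observable_cst.
by apply: mx_observableM => //; exact: mx_observable_eval_letter.
Qed.

Lemma mx_observable_deriv_letter P l : mx_observable v (fun X => deriv_letter P X l).
Proof.
rewrite /deriv_letter; case: (l.1); last exact: mx_observable_cst.
have oe := mx_observable_eval_letter l; have oP := mx_observable_cst v P.
by apply: mx_observableD; [|apply: mx_observableN]; exact: mx_observableM.
Qed.

Lemma mx_observable_deriv_word P w : mx_observable v (fun X => deriv_word P X w).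
Proof.
elim: w => [|l w IH] /=; first exact: mx_observable_cst.
apply: mx_observableD; apply: mx_observableM => //.
- exact: mx_observable_deriv_letter.
- exact: mx_observable_eval_word.
- exact: mx_observable_eval_letter.
Qed.

Lemma mx_observable_word_gradient Z w : mx_observable v (fun X => word_gradient X Z w).
Proof.
suff: forall F, mx_observable v F -> mx_observable v (fun X => word_gradient X (F X) w).
  by apply; exact: mx_observable_cst.
elim: w => [|l w IH] F oF /=; first exact: mx_observable_cst.
have oe := mx_observable_eval_letter l; have ow := mx_observable_eval_word w.
apply: mx_observableD; last by apply: IH; exact: mx_observableM.
case: (l.1); last exact: mx_observable_cst.
by apply: mx_observableD; [|apply: mx_observableN]; apply: mx_observableM => //;
  exact: mx_observableM.
Qed.

Lemma mx_tangent_eval_letter u l : u^t* *m v = 0 ->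
  mx_tangent v u (fun X => eval_letter X l) (fun X => deriv_letter (u *m u^t*) X l).
Proof.
move=> uv; rewrite /eval_letter /deriv_letter; case: l => [[] a] /=; last
  exact: mx_tangent_cst.
set P := u *m u^t*.
have Ph : P^t* = P by rewrite /P trmx_mul map_mxM trmxCK.
have oid := mx_observable_id v.
have oP : mx_observable v (fun X => P *m X).
  by apply: mx_observableM => //; exact: mx_observable_cst.
have oa := mx_observable_cst v a; have o0 := mx_observable_cst v 0.
have t1 := mx_tangentM uv oid oP oa o0 (mx_tangent_id v u) (mx_tangent_cst v u a).
have t2 := mx_tangentM uv (mx_observableM oid oa)
  (mx_observableD (mx_observableM oP oa) (mx_observableM oid o0))
  (mx_observable_adj oid) (mx_observableN (mx_observable_adj oP)) t1
  (mx_tangent_adj (mx_tangent_id v u)).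
move=> i j; apply: tangent_eq (t2 i j) => X //.
rewrite /eval_letter /= mulmx0 addr0 trmx_mul map_mxM Ph mulmxN.
by rewrite !mulmxA.
Qed.

Lemma mx_tangent_eval_word u w : u^t* *m v = 0 ->
  mx_tangent v u (fun X => eval_word X w) (fun X => deriv_word (u *m u^t*) X w).
Proof.
move=> uv; elim: w => [|l w IH] /=; first exact: mx_tangent_cst.
apply: mx_tangentM => //.
- exact: mx_observable_eval_letter.
- exact: mx_observable_deriv_letter.
- exact: mx_observable_eval_word.
- exact: mx_observable_deriv_word.
- exact: mx_tangent_eval_letter.
Qed.

Lemma deriv_letter_linear z P P' X l : deriv_letter (z *: P + P') X l = z *:
  deriv_letter P X l + deriv_letter P' X l.
Proof.
rewrite /deriv_letter; case: ifP => _; last by rewrite scaler0 addr0.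
rewrite mulmxDl mulmxDr -scalemxAl -scalemxAr scalerBr.
by rewrite opprD addrACA.
Qed.

Lemma deriv_word_linear z P P' X w : deriv_word (z *: P + P') X w = z *:
  deriv_word P X w + deriv_word P' X w.
Proof.
elim: w => [|l w IH] /=; first by rewrite scaler0 addr0.
rewrite IH deriv_letter_linear mulmxDl mulmxDr -scalemxAl -scalemxAr scalerDr.
by rewrite addrACA.
Qed.

Lemma tr_deriv_word P X Z w : \tr (Z *m deriv_word P X w) = \tr (P *m
  word_gradient X Z w).
Proof.
elim: w Z => [|l w IH] Z /=; first by rewrite !mulmx0.
rewrite mulmxDr mulmxA linearD /= mulmxA IH mulmxDr linearD /=; congr (_ + _).
rewrite /deriv_letter; case: (l.1) => /=; last by rewrite mulmx0 mul0mx mulmx0.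
rewrite mulmxBr mulmxBl mulmxBr !linearB /=; congr (_ - _).
  by rewrite -!mulmxA mxtrace_mulC -!mulmxA.
by rewrite -!mulmxA mulmxA mxtrace_mulC -!mulmxA.
Qed.

Lemma opbnd_word_gradient X Z w : G X -> opbnd Z 1 -> contractive w ->
  opbnd (word_gradient X Z w) (2 * (size w)%:R).
Proof.
move=> GX; elim: w Z => [|l w IH] Z hZ /=; first by rewrite mulr0 => _; exact: opbnd0.
move=> /contractive_cons[hl hw].
have he := opbnd_eval_letter GX hl; have hv := opbnd_eval_word GX hw.
have M1 A B : opbnd A 1 -> opbnd B 1 -> opbnd (A *m B : MX) 1.
  by move=> hA hB; rewrite -[1]mulr1; exact: opbndM.
rewrite -[(size w).+1]addn1 natrD mulrDr [X in opbnd _ X]addrC.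
apply: opbndD; last by apply: IH; [exact: M1|].
case: (l.1); last by apply: (opbnd_le _ (@opbnd0 R n)); rewrite mulr1.
rewrite mulr1 [X in opbnd _ X](_ : 2 = 1 + 1) //.
apply: (opbndD (M1 _ _ _ hZ) (opbndN (M1 _ _ _ he))); exact: M1.
Qed.

(** Treats together the normalized trace, Y = 1/n, and the vector state,
    Y = v v*. *)
Definition trace_contraction Y := opbnd Y 1 /\
  forall M c, opbnd M c -> normc (\tr (Y *m M)) <= c.

Lemma trace_contraction_vector : trace_contraction (v *m v^t*).
Proof. by split=> [|M c hM]; [exact: opbnd_proj|exact: normc_vector_state_opbnd]. Qed.

Lemma trace_contraction_normalized : (0 < n)%N ->
  trace_contraction ((n%:R^-1)%:M).
Proof.
move=> n0; split=> [|M c hM].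
  rewrite -scalemx1 -[X in opbnd _ X]mulr1.
  apply: (opbnd_le _ (opbndZ _ (@opbnd1 R n))).
  by rewrite !mulr1 normcV normc_nat invf_le1 ?ler1n ?ltr0n.
rewrite mul_scalar_mx linearZ /= normcM normcV normc_nat.
rewrite ler_pdivrMl ?ltr0n //; exact: normc_tr_opbnd.
Qed.

(** The weights allowed in the loop equation.  Their derivative is represented by
    a matrix of bounded operator norm, hence contributes a bounded term to an
    equation whose main term has size n. *)
Record smooth (F : MX -> C) (gF : MX -> MX) (b : R) : Prop := Smooth {
  smooth_obs : observable v F;
  smooth_grad_obs : mx_observable v gF;
  smooth_bound : forall X, G X -> normc (F X) <= 1;
  smooth_grad_bound : forall X, G X -> opbnd (gF X) b;
  smooth_tangent : forall u, u^t* *m v = 0 ->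
    tangent v u F (fun X => \tr (u *m u^t* *m gF X)) }.

Lemma smooth_1 : smooth (fun=> 1) (fun=> 0) 0.
Proof.
split; [exact: observable_cst|exact: mx_observable_cst| | |].
- by move=> X _; rewrite normc1.
- by move=> X _; exact: opbnd0.
- move=> u uv; apply: tangent_eq (tangent_cst v u 1) => X //.
  by rewrite mulmx0 mxtrace0.
Qed.

Lemma smoothM F gF b F' gF' b' : smooth F gF b -> smooth F' gF' b' ->
  0 <= b -> 0 <= b' ->
  smooth (fun X => F X * F' X) (fun X => F' X *: gF X + F X *: gF' X) (b + b').
Proof.
move=> [oF ogF bF bgF tF] [oF' ogF' bF' bgF' tF'] b0 b0'; split.
- exact: observableM.
- by apply: mx_observableD; exact: mx_observableZ.
- move=> X GX; rewrite normcM -[1]mulr1.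
  by apply: ler_pM; rewrite ?normc_ge0 //; [exact: bF|exact: bF'].
- move=> X GX; apply: opbndD.
  + apply: (opbnd_le _ (opbndZ _ (bgF X GX))).
    by rewrite -[leRHS]mul1r; apply: ler_wpM2r => //; exact: bF'.
  + apply: (opbnd_le _ (opbndZ _ (bgF' X GX))).
    by rewrite -[leRHS]mul1r; apply: ler_wpM2r => //; exact: bF.
- move=> u uv.
  have oP := mx_observable_cst v (u *m u^t*).
  have o1 := observable_tr (mx_observableM oP ogF).
  have o2 := observable_tr (mx_observableM oP ogF').
  apply: tangent_eq (tangentM uv oF o1 oF' o2 (tF u uv) (tF' u uv)) => X //.
  by rewrite mulmxDr -!scalemxAr linearD !linearZ /= mulrC.
Qed.

Lemma smooth_word Y w : trace_contraction Y -> contractive w ->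
  smooth (fun X => \tr (Y *m eval_word X w)) (fun X => word_gradient X Y w) (2
    * (size w)%:R).
Proof.
move=> [Y1 Y2] hw; split.
- apply: observable_tr; apply: mx_observableM; first exact: mx_observable_cst.
  exact: mx_observable_eval_word.
- exact: mx_observable_word_gradient.
- by move=> X GX; apply: Y2; exact: opbnd_eval_word.
- by move=> X GX; exact: opbnd_word_gradient.
- move=> u uv.
  have t := mx_tangentM uv (mx_observable_cst v Y) (mx_observable_cst v 0)
     (mx_observable_eval_word w) (mx_observable_deriv_word (u *m u^t*) w)
       (mx_tangent_cst v u Y)
     (mx_tangent_eval_word w uv).
  apply: tangent_eq (tangent_tr t) => X //.
  by rewrite mul0mx add0r tr_deriv_word.
Qed.

(** Expanding u u* for u = x + y and for u = x + i y gives two equations between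
    the values of L at x y* and at y x*, which only 0 solves. *)
Lemma polarization (L : MX -> C) :
  (forall z P P', L (z *: P + P') = z * L P + L P') ->
  (forall u, u^t* *m v = 0 -> L (u *m u^t*) = 0) ->
  forall x y, x^t* *m v = 0 -> y^t* *m v = 0 -> L (x *m y^t*) = 0.
Proof.
move=> lin L0 x y xv yv.
have add P P' : L (P + P') = L P + L P'.
  by have := lin 1 P P'; rewrite scale1r mul1r.
have L00 : L 0 = 0 by have := add 0 0; rewrite addr0 -{1}[L 0]addr0 => /addrI <-.
have scal z P : L (z *: P) = z * L P by have := lin z P 0; rewrite !addr0 L00 addr0.
have step z : L (x *m (z *: y)^t*) + L ((z *: y) *m x^t*) = 0.
  have zyv : (z *: y)^t* *m v = 0 by rewrite linearZ /= map_mxZ -scalemxAl yv scaler0.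
  have := L0 (x + z *: y); rewrite linearD /= map_mxD mulmxDl xv zyv addr0 =>
    /(_ erefl).
  rewrite mulmxDl !mulmxDr !add (L0 x xv) (L0 _ zyv) add0r addr0.
  by rewrite addrC [X in X = _]addrC.
have adjZ z : (z *: y)^t* = z^* *: y^t* by rewrite linearZ /= map_mxZ.
have := step 1; have := step 'i%C; rewrite !adjZ -!scalemxAr -!scalemxAl !scal.
rewrite rmorph1 !mul1r.
have -> : ('i%C : C)^* = - 'i%C by apply/eqP; rewrite eq_complex /= oppr0 !eqxx.
rewrite mulNr [X in X = _ -> _]addrC => /eqP; rewrite subr_eq0 => /eqP h1 h2.
have /mulfI h : ('i%C : C) != 0.
  by apply/eqP => -[/eqP]; rewrite oner_eq0.
move: h2; rewrite (h _ _ h1) -mulr2n => /eqP; rewrite mulrn_eq0 /=.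
by move/eqP.
Qed.

Local Notation Q := (1%:M - v *m v^t*).

Lemma compl_adj : Q^t* = Q.
Proof. by rewrite linearB /= map_mxB trmx1 map_mx1 trmx_mul map_mxM trmxCK. Qed.

Lemma compl_v : Q *m v = 0.
Proof. by rewrite mulmxBl mul1mx -mulmxA (unit_dot v1) mulmx1 subrr. Qed.

(** Rotations only provide the directions u u* with u orthogonal to v.  The
    identity is complex linear in the direction, so it extends by polarization
    to (Q e_k) (Q e_m)*, the compression of a matrix unit. *)
Lemma schwinger_dyson (E : (MX -> C) -> C) F gF b Y w k m :
  invariant_mean v E -> smooth F gF b ->
  E (fun X => \tr (Y *m deriv_word (Q *m delta_mx k m *m Q) X w) * F X +
     \tr (Y *m eval_word X w) * \tr (Q *m delta_mx k m *m Q *m gF X)) = 0.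
Proof.
move=> hE [oF ogF bF bgF tF].
pose L P := E (fun X => \tr (Y *m deriv_word P X w) * F X +
     \tr (Y *m eval_word X w) * \tr (P *m gF X)).
have oY := mx_observable_cst v Y.
have o1 : observable v (fun X => \tr (Y *m eval_word X w)).
  by apply: observable_tr; apply: mx_observableM => //; exact: mx_observable_eval_word.
have o2 P : observable v (fun X => \tr (Y *m deriv_word P X w)).
  by apply: observable_tr; apply: mx_observableM => //; exact: mx_observable_deriv_word.
have o3 P : observable v (fun X => \tr (P *m gF X)).
  by apply: observable_tr; apply: mx_observableM => //; exact: mx_observable_cst.
have oL P : observable v (fun X => \tr (Y *m deriv_word P X w) * F X +
     \tr (Y *m eval_word X w) * \tr (P *m gF X)).
  by apply: observableD; exact: observableM.
have -> : Q *m delta_mx k m *m Q =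
    (Q *m (delta_mx k 0 : 'cV[C]_n)) *m (Q *m (delta_mx m 0 : 'cV[C]_n))^t*.
  rewrite trmx_mul map_mxM compl_adj mulmxA; congr (_ *m _).
  rewrite -mulmxA; congr (_ *m _); rewrite trmx_delta map_delta_mx.
  by rewrite mul_delta_mx.
have orth j : (Q *m (delta_mx j 0 : 'cV[C]_n))^t* *m v = 0.
  by rewrite trmx_mul map_mxM compl_adj -mulmxA compl_v mulmx0.
apply: (@polarization L) => //.
- move=> z P P'; rewrite /L -(mean_lin hE) //; congr E; apply/funext => X.
  rewrite deriv_word_linear mulmxDr -scalemxAr mulmxDl -scalemxAl.
  by rewrite !linearD !linearZ /=; ring.
- move=> u uv; rewrite /L.
  have t := mx_tangentM uv oY (mx_observable_cst v 0)
     (mx_observable_eval_word w) (mx_observable_deriv_word (u *m u^t*) w)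
       (mx_tangent_cst v u Y)
     (mx_tangent_eval_word w uv).
  have {}t : tangent v u (fun X => \tr (Y *m eval_word X w))
      (fun X => \tr (Y *m deriv_word (u *m u^t*) X w)).
    by apply: tangent_eq (tangent_tr t) => X //; rewrite mul0mx add0r.
  exact: (mean_tangent uv hE (observableM o1 oF) (oL _)
    (tangentM uv o1 (o2 _) oF (o3 _) t (tF u uv))).
Qed.

End Words.

(** * The loop equation *)

Section LoopEquation.
Variables (R : realType) (n : nat) (v : 'cV[R[i]]_n).
Hypothesis v1 : l2norm v = 1.
Local Notation C := R[i].
Local Notation MX := 'M[C]_n.
Local Notation G := (stab_unitary v).
Local Notation Q := (1%:M - v *m v^t* : 'M[C]_n).
Implicit Types (X Y Z A B D h M : MX) (l : bool * MX) (w : seq (bool * MX)).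

Lemma tr_mul_delta A i j : \tr (A *m delta_mx i j) = A j i.
Proof.
rewrite /mxtrace (bigD1 j) //= big1 ?addr0 => [|k kj]; rewrite mxE (bigD1 i)
  //= big1 ?addr0.
- by rewrite mxE !eqxx mulr1.
- by move=> k ki; rewrite mxE (negPf ki) mulr0.
- by rewrite mxE eqxx (negPf kj) mulr0.
- by move=> m mi; rewrite mxE (negPf mi) mulr0.
Qed.

Lemma mul_delta_mul A B i j : A *m delta_mx i j *m B = col i A *m row j B.
Proof.
apply/matrixP => k m; rewrite mxE [RHS]mxE big_ord1 !mxE (bigD1 j) //= big1 ?addr0.
  rewrite mxE (bigD1 i) //= big1 ?addr0 => [|q qi]; rewrite mxE ?eqxx ?mulr1 //.
  by rewrite (negPf qi) mulr0.
move=> q qj; rewrite mxE big1 ?mul0r // => p _.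
by rewrite mxE (negPf qj) andbF mulr0.
Qed.

Lemma tr_delta_delta A B k m :
  \tr (A *m delta_mx m k *m B *m delta_mx k m) = A m m * B k k.
Proof. by rewrite tr_mul_delta mul_delta_mul mxE big_ord1 !mxE. Qed.

Section Contraction.
Variable q : MX.

(** Contracting a pair of matrix units cuts a trace into two. *)
Lemma sum_tr_split Z h D :
  \sum_k \sum_m \tr (Z *m delta_mx m k *m h *m (q *m delta_mx k m *m q) *m D) =
  \tr (h *m q) * \tr (Z *m q *m D).
Proof.
transitivity (\sum_k \sum_m (q *m D *m Z) m m * (h *m q) k k).
  apply: eq_bigr => k _; apply: eq_bigr => m _; rewrite -tr_delta_delta.
  move: (delta_mx m k) (delta_mx k m) => e e'.
  transitivity (\tr ((Z *m e *m (h *m q) *m e') *m (q *m D))).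
    by rewrite !mulmxA.
  by rewrite mxtrace_mulC !mulmxA.
under eq_bigr do rewrite -mulr_suml.
rewrite -mulr_sumr mulrC; congr (_ * _).
by rewrite -[LHS]/(\tr (q *m D *m Z)) mxtrace_mulC mulmxA.
Qed.

Lemma sum_tr_join A B D :
  \sum_k \sum_m \tr (A *m (q *m delta_mx k m *m q) *m B *m delta_mx m k *m D) =
  \tr (q *m B) * \tr (A *m q *m D).
Proof.
transitivity (\sum_k \sum_m (q *m B) m m * (D *m A *m q) k k).
  apply: eq_bigr => k _; apply: eq_bigr => m _; rewrite -tr_delta_delta.
  move: (delta_mx m k) (delta_mx k m) => e e'.
  transitivity (\tr ((A *m q *m e') *m (q *m B *m e *m D))).
    by rewrite !mulmxA.
  by rewrite mxtrace_mulC !mulmxA.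
under eq_bigr do rewrite -mulr_suml.
rewrite -mulr_sumr; congr (_ * _).
by rewrite -[LHS]/(\tr (D *m A *m q)) -mulmxA mxtrace_mulC.
Qed.

Lemma sum_tr_tr A B M :
  \sum_k \sum_m \tr (A *m delta_mx m k *m B) * \tr (q *m delta_mx k m *m q *m M) =
  \tr (A *m (q *m M *m q) *m B).
Proof.
transitivity (\sum_k \sum_m (B *m A) k m * (q *m M *m q) m k).
  apply: eq_bigr => k _; apply: eq_bigr => m _; rewrite -!tr_mul_delta.
  move: (delta_mx m k) (delta_mx k m) => e e'; congr (_ * _).
    by rewrite mxtrace_mulC mulmxA.
  by rewrite -(mulmxA (q *m e')) mxtrace_mulC !mulmxA.
rewrite mxtrace_mulC (mulmxA B A); apply: eq_bigr => k _.
by rewrite [RHS]mxE.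
Qed.

(** The result of contracting the derivative of w against a matrix unit, when h
    stands between that unit and w: every conjugated letter gives a cut before
    it and a cut after it. *)
Fixpoint contraction X Z h w : C :=
  if w is l :: w' then
    (if l.1 then \tr (h *m q) * \tr (Z *m q *m (eval_letter X l *m eval_word X w'))
       - \tr (h *m eval_letter X l *m q) * \tr (Z *m q *m eval_word X w') else 0)
    + contraction X Z (h *m eval_letter X l) w'
  else 0.

Lemma sum_tr_deriv_word X Z h w :
  \sum_k \sum_m \tr (Z *m delta_mx m k *m h *m deriv_word (q *m delta_mx k m *m
    q) X w) =
  contraction X Z h w.
Proof.
elim: w h => [|l w IH] h /=.
  by apply: big1 => k _; apply: big1 => m _; rewrite mulmx0 mxtrace0.
rewrite -IH -(sum_tr_split Z h) -(sum_tr_split Z (h *m eval_letter X l)).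
transitivity (\sum_k \sum_m
   (\tr (Z *m delta_mx m k *m h *m (deriv_letter (q *m delta_mx k m *m q) X l
     *m eval_word X w)) +
    \tr (Z *m delta_mx m k *m (h *m eval_letter X l) *m deriv_word (q *m
      delta_mx k m *m q) X w))).
  apply: eq_bigr => k _; apply: eq_bigr => m _.
  by rewrite mulmxDr linearD /= !mulmxA.
under eq_bigr do rewrite big_split; rewrite big_split /=; congr (_ + _).
rewrite /deriv_letter; case: (l.1); last first.
  by apply: big1 => k _; apply: big1 => m _; rewrite mul0mx mulmx0 mxtrace0.
rewrite -sumrB; apply: eq_bigr => k _; rewrite -sumrB; apply: eq_bigr => m _.
move: (q *m delta_mx k m *m q) (eval_letter X l) (eval_word X w) => x c y.
by rewrite mulmxBl mulmxBr linearB /= !mulmxA.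
Qed.

Lemma sum_tr_deriv_letter X Y l D :
  \sum_k \sum_m \tr (Y *m deriv_letter (q *m delta_mx k m *m q) X l *m delta_mx
    m k *m D) =
  if l.1 then \tr (q *m eval_letter X l) * \tr (Y *m q *m D)
    - \tr q * \tr (Y *m eval_letter X l *m q *m D) else 0.
Proof.
rewrite /deriv_letter; case: (l.1); last first.
  by apply: big1 => k _; apply: big1 => m _; rewrite mulmx0 !mul0mx mxtrace0.
rewrite -[q in X in _ - X * _]mulmx1.
rewrite -(sum_tr_join Y) -(sum_tr_join (Y *m eval_letter X l)) -sumrB.
apply: eq_bigr => k _; rewrite -sumrB; apply: eq_bigr => m _.
move: (q *m delta_mx k m *m q) (eval_letter X l) => x c.
by rewrite mulmxBr !mulmxBl linearB /= mulmx1 !mulmxA.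
Qed.

Lemma sum_loop X Y l w M f :
  \sum_k \sum_m (\tr (Y *m deriv_word (q *m delta_mx k m *m q) X
        [:: l, (false, delta_mx m k) & w]) * f +
     \tr (Y *m eval_word X [:: l, (false, delta_mx m k) & w]) *
     \tr (q *m delta_mx k m *m q *m M)) =
  ((if l.1 then \tr (q *m eval_letter X l) * \tr (Y *m q *m eval_word X w)
      - \tr q * \tr (Y *m eval_letter X l *m q *m eval_word X w) else 0)
    + contraction X (Y *m eval_letter X l) 1%:M w) * f
    + \tr (Y *m eval_letter X l *m (q *m M *m q) *m eval_word X w).
Proof.
rewrite -sum_tr_deriv_letter -sum_tr_deriv_word -sum_tr_tr mulrDl !mulr_suml
  -!big_split /=.
apply: eq_bigr => k _; rewrite !mulr_suml -!big_split /=; apply: eq_bigr => m _.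
rewrite [eval_letter X (_, _)]/= [deriv_letter _ _ (false, _)]/= mul0mx add0r.
move: (delta_mx m k) => e; move: (q *m delta_mx k m *m q) => x.
rewrite -mulrDl; congr (_ * _ + _ * _); last by rewrite !mulmxA.
by rewrite mulmxDr linearD /= mulmx1 !mulmxA.
Qed.

End Contraction.

Lemma tr_compl : \tr Q = n%:R - 1.
Proof.
rewrite linearB /= mxtrace1; congr (_ - _).
by rewrite mxtrace_mulC (unit_dot v1) mxtrace1.
Qed.

Section Mean.
Variable E : (MX -> C) -> C.
Hypothesis hE : invariant_mean v E.

Lemma meanD f g : observable v f -> observable v g ->
  E (fun X => f X + g X) = E f + E g.
Proof.
move=> of_ og; rewrite -[E f]mul1r -(mean_lin hE) //; congr E.
by apply/funext => X; rewrite mul1r.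
Qed.

Lemma meanZ c f : observable v f -> E (fun X => c * f X) = c * E f.
Proof.
move=> of_; have o0 := observable_cst v 0.
rewrite -[RHS]addr0 -[X in _ + X](mean_cst hE 0) -(mean_lin hE) //; congr E.
by apply/funext => X; rewrite addr0.
Qed.

Lemma mean_sum (I : Type) (r : seq I) (f : I -> MX -> C) :
  (forall i, observable v (f i)) ->
  E (fun X => \sum_(i <- r) f i X) = \sum_(i <- r) E (f i).
Proof.
move=> of_; elim: r => [|a r IH].
  rewrite big_nil -[RHS](mean_cst hE 0); congr E.
  by apply/funext => X; rewrite big_nil.
rewrite big_cons -IH -meanD //; last exact: observable_sum.
by congr E; apply/funext => X; rewrite big_cons.
Qed.

Lemma mean_eq f g : observable v f -> observable v g ->
  (forall X, G X -> f X = g X) -> E f = E g.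
Proof.
move=> of_ og fg; apply/eqP; rewrite -subr_eq0; apply/eqP/eq0_normc.
have e : E f - E g = E (fun X => f X - g X).
  rewrite -[- E g]mulN1r -meanZ // -meanD //; last exact: observableZ.
  by congr E; apply/funext => X; rewrite mulN1r.
apply/eqP; rewrite eq_le normc_ge0 andbT e.
have := @mean_bound _ _ _ _ hE (fun X => f X - g X) 0 (observableB of_ og).
rewrite mulr0; apply => X GX; by rewrite fg // subrr normc0.
Qed.

(** Here the matrix unit sits between l and w.  The last term comes from the
    derivative of the weight F; its two projections Q are those of the
    direction. *)
Lemma loop_equation F gF b Y l w : smooth v F gF b ->
  E (fun X => ((if l.1 then \tr (Q *m eval_letter X l) * \tr (Y *m Q *m eval_word X w)
      - (n%:R - 1) * \tr (Y *m eval_letter X l *m Q *m eval_word X w) else 0)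
    + contraction Q X (Y *m eval_letter X l) 1%:M w) * F X
    + \tr (Y *m eval_letter X l *m (Q *m gF X *m Q) *m eval_word X w)) = 0.
Proof.
move=> sF; have [oF ogF _ _ _] := sF.
pose W k m := [:: l, (false, delta_mx m k) & w].
pose f k m X := \tr (Y *m deriv_word (Q *m delta_mx k m *m Q) X (W k m)) * F X +
     \tr (Y *m eval_word X (W k m)) * \tr (Q *m delta_mx k m *m Q *m gF X).
have of_ k m : observable v (f k m).
  have oc A := mx_observable_cst v A.
  apply: observableD; apply: observableM => //; apply: observable_tr.
  - by apply: mx_observableM => //; exact: mx_observable_deriv_word.
  - by apply: mx_observableM => //; exact: mx_observable_eval_word.
  - by apply: mx_observableM.
have : E (fun X => \sum_k \sum_m f k m X) = 0.
  rewrite mean_sum => [|k]; last exact: observable_sum.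
  apply: big1 => k _; rewrite mean_sum //; apply: big1 => m _.
  exact: (schwinger_dyson v1 _ _ _ _ hE sF).
move=> E0; rewrite -[RHS]E0; congr E; apply/funext => X.
by rewrite -tr_compl /f /W sum_loop.
Qed.

End Mean.
End LoopEquation.

(** * Cutting an alternating word after its first letter *)

Section Cut.
Variables (R : realType) (n : nat) (v : 'cV[R[i]]_n).
Hypothesis v1 : l2norm v = 1.
Hypothesis n_gt1 : (1 < n)%N.
Local Notation C := R[i].
Local Notation MX := 'M[C]_n.
Local Notation G := (stab_unitary v).
Local Notation p := (v *m v^t* : 'M[C]_n).
Local Notation Q := (1%:M - v *m v^t* : 'M[C]_n).
Implicit Types (X Y Z : MX) (l x y : bool * MX) (w h H D : seq (bool * MX)).

Definition alternates w : bool := sorted (fun l m => l.1 != m.1) w.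
Definition traceless w := forall l, l \in w -> \tr l.2 = 0.
Definition admissible w := [/\ alternates w, traceless w & contractive w].

Lemma admissible_cons l w : admissible (l :: w) -> admissible w /\
  [/\ \tr l.2 = 0, opbnd l.2 1 & (if w is m :: _ then l.1 != m.1 else true)].
Proof.
move=> [a t c]; split; first split.
- by move: a; rewrite /alternates /=; exact: path_sorted.
- by move=> m mw; apply: t; rewrite inE mw orbT.
- by move=> m mw; apply: c; rewrite inE mw orbT.
split; [by apply: t; rewrite inE eqxx|by apply: c; rewrite inE eqxx|].
by move: a; rewrite /alternates /=; case: w {t c} => //= m w /andP[].
Qed.

Lemma admissible_catl h H : admissible (h ++ H) -> admissible h.
Proof.
move=> [a t c]; split.
- by move: a; rewrite /alternates; case: h {t c} => //= l h; rewrite cat_path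
  => /andP[].
- by move=> m mw; apply: t; rewrite mem_cat mw.
- by move=> m mw; apply: c; rewrite mem_cat mw.
Qed.

Lemma tr_eval_letter X l : G X -> \tr (eval_letter X l) = \tr l.2.
Proof.
move=> [/unitarymxP XU _]; rewrite /eval_letter; case: (l.1) => //.
by rewrite mxtrace_mulC mulmxA (mulmx1C XU) mul1mx.
Qed.

Lemma opbnd_complM M c : opbnd M c -> opbnd (Q *m M) c.
Proof. by move=> hM; rewrite -[c]mul1r; apply: opbndM => //; exact: opbnd_compl. Qed.

Lemma tr_compl_traceless X l : G X -> \tr l.2 = 0 -> opbnd l.2 1 ->
  normc (\tr (Q *m eval_letter X l)) <= 1.
Proof.
move=> GX tl bl; rewrite mulmxBl mul1mx linearB /= tr_eval_letter // tl sub0r normcN.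
by have [_ h] := trace_contraction_vector v1; apply: h; exact:
  (opbnd_eval_letter GX bl).
Qed.

Lemma observable_contraction w :
  forall Zf hf, mx_observable v Zf -> mx_observable v hf ->
  observable v (fun X => contraction Q X (Zf X) (hf X) w).
Proof.
elim: w => [|l w IH] Zf hf oZ oh /=; first exact: observable_cst.
have oe := mx_observable_eval_letter v l; have ow := mx_observable_eval_word v w.
have oQ := mx_observable_cst v Q.
apply: observableD; last by apply: IH => //; exact: mx_observableM.
case: (l.1); last exact: observable_cst.
apply: observableB; apply: observableM; apply: observable_tr.
- exact: mx_observableM.
- by apply: mx_observableM; exact: mx_observableM.
- by apply: mx_observableM => //; exact: mx_observableM.
- by apply: mx_observableM => //; exact: mx_observableM.
Qed.

Variable E : (MX -> C) -> C.
Hypothesis hE : invariant_mean v E.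

(** The weight F closes the induction on m: the loop equation turns one trace into
    a product of two, and the factor that is not estimated joins F. *)
Definition tracial_bound_for (m : nat) (b K : R) := forall w, admissible w ->
  (0 < size w <= m)%N -> forall F gF b', smooth v F gF b' -> 0 <= b' <= b ->
  normc (E (fun X => n%:R^-1 * \tr (eval_word X w) * F X)) <= K / n%:R.

Section Induction.
Variables (m : nat) (b K b0 : R) (F : MX -> C) (gF : MX -> MX).
Variable Y : MX.
Hypothesis hK : tracial_bound_for m b K.
Hypothesis sF : smooth v F gF b0.
Hypothesis b0_ge0 : 0 <= b0.
(* The words that join the weight have at most m + 3 letters, each of which adds
   2 to the bound of the gradient. *)
Hypothesis b0_le : 2 * (m + 3)%:R + b0 <= b.
Hypothesis hY : trace_contraction Y.

Lemma n_neq0 : (n%:R : C) != 0.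
Proof. by rewrite pnatr_eq0 -lt0n ltnW. Qed.

(** The trace of h Q is n times the normalized trace of h minus its vector state;
    the factor n is compensated by the bound K / n for h. *)
Lemma split_bound h D : admissible h -> (0 < size h <= m)%N ->
  contractive D -> (size D <= m + 3)%N ->
  normc (E (fun X => \tr (eval_word X h *m Q) * \tr (Y *m eval_word X D) * F
    X)) <= K + 2.
Proof.
move=> ah sh cD sD.
have sDF := smoothM (smooth_word v hY cD) sF (mulr_ge0 (ler0n _ _) (ler0n _ _)) b0_ge0.
have ch : contractive h by case: ah.
have sph := smooth_word v (trace_contraction_vector v1) ch.
have o1 := smooth_obs sDF.
have o2 := smooth_obs sph.
have o3 : observable v (fun X => \tr (eval_word X h)).
  by apply: observable_tr; exact: mx_observable_eval_word.
have o4 : observable v (fun X => n%:R^-1 * \tr (eval_word X h) * (\tr (Y *m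
  eval_word X D) * F X)).
  by apply: observableM => //; exact: observableZ.
have o5 : observable v (fun X => \tr (p *m eval_word X h) * (\tr (Y *m
  eval_word X D) * F X)).
  exact: observableM.
have -> : E (fun X => \tr (eval_word X h *m Q) * \tr (Y *m eval_word X D) * F X) =
    n%:R * E (fun X => n%:R^-1 * \tr (eval_word X h) * (\tr (Y *m eval_word X
      D) * F X)) +
    -1 * E (fun X => \tr (p *m eval_word X h) * (\tr (Y *m eval_word X D) * F X)).
  rewrite -!(meanZ hE) // -(meanD hE); try exact: observableZ.
  congr E; apply/funext => X.
  rewrite mulmxBr mulmx1 linearB /= (mxtrace_mulC _ p).
  move: (\tr (eval_word X h)) (\tr (p *m eval_word X h)) (\tr (Y *m eval_word X
    D)) (F X) => t1 t2 t3 t4.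
  by field; exact: n_neq0.
apply: le_trans (le_normcD _ _) _; apply: lerD.
  rewrite normcM normc_nat mulrC -ler_pdivlMr ?ltr0n ?(ltnW n_gt1) //.
  apply: hK => //; first exact: sDF.
  rewrite addr_ge0 ?mulr_ge0 //=; apply: le_trans b0_le; rewrite lerD2r ler_pM2l //.
  by rewrite ler_nat.
rewrite mulN1r normcN -[leRHS]mulr1; apply: (mean_bound hE) => // X GX.
rewrite normcM -[1]mulr1; apply: ler_pM; rewrite ?normc_ge0 //.
- exact: (smooth_bound sph).
- exact: (smooth_bound sDF).
Qed.

(** Each cut splits off the trace of a nonempty prefix of h ++ H, which is again
    alternating and traceless and has at most m letters. *)
Lemma contraction_bound x h H : opbnd x.2 1 -> (0 < size h)%N ->
  admissible (h ++ H) -> (size (h ++ H) <= m)%N -> 0 <= K ->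
  normc (E (fun X => contraction Q X (Y *m eval_letter X x) (eval_word X h) H * F X))
    <= (size H)%:R * (2 * (K + 2)).
Proof.
move=> bx; elim: H h => [|l H IH] h h0 ah sh K0 /=.
  rewrite mul0r -[X in _ <= X](@normc0 R).
  have -> : (fun X => 0 * F X) = (fun=> 0) by apply/funext => X; rewrite mul0r.
  by rewrite (mean_cst hE).
have ah' : admissible ((h ++ [:: l]) ++ H) by rewrite -catA.
have sh' : (size ((h ++ [:: l]) ++ H) <= m)%N by rewrite -catA.
have ch : contractive (h ++ l :: H) by case: ah.
have [_ cl] : contractive h /\ contractive (l :: H) by apply/contractive_cat.
have [bl cH] : opbnd l.2 1 /\ contractive H by apply/contractive_cons.
have cQ : opbnd ((false, Q) : bool * MX).2 1 by exact: opbnd_compl.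
have sF1 := smooth_obs sF.
pose D1 := [:: x, (false, Q), l & H]; pose D2 := [:: x, (false, Q) & H].
have cD1 : contractive D1.
  apply/contractive_cons; split; first exact: bx.
  by apply/contractive_cons; split; [exact: cQ|exact: cl].
have cD2 : contractive D2.
  apply/contractive_cons; split; first exact: bx.
  by apply/contractive_cons; split; [exact: cQ|exact: cH].
have szh : (size h + (size H).+1 <= m)%N by move: sh; rewrite size_cat.
have sD1 : (size D1 <= m + 3)%N.
  by rewrite /D1 /= addn3 !ltnS; apply: leq_trans szh; rewrite addnS ltnW //
    ltnS leq_addl.
have sD2 : (size D2 <= m + 3)%N by apply: leq_trans sD1.
have oev := mx_observable_eval_word v; have oY := mx_observable_cst v Y.
have oQ := mx_observable_cst v Q; have oe := mx_observable_eval_letter v.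
pose g1 X := \tr (eval_word X h *m Q) * \tr (Y *m eval_word X D1) * F X.
pose g2 X := \tr (eval_word X (h ++ [:: l]) *m Q) * \tr (Y *m eval_word X D2) * F X.
pose g3 X := contraction Q X (Y *m eval_letter X x) (eval_word X (h ++ [:: l])) H * F X.
have o1 : observable v g1.
  by apply: observableM => //; apply: observableM; apply: observable_tr;
    apply: mx_observableM.
have o2 : observable v g2.
  by apply: observableM => //; apply: observableM; apply: observable_tr;
    apply: mx_observableM.
have o3 : observable v g3.
  apply: observableM => //; apply: observable_contraction => //.
  exact: mx_observableM.
have b1 : normc (E g1) <= K + 2.
  apply: split_bound => //; first exact: admissible_catl ah.
  by rewrite h0 /=; apply: leq_trans szh; rewrite leq_addr.
have b2 : normc (E g2) <= K + 2.
  apply: split_bound => //; first exact: admissible_catl ah'.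
  by rewrite size_cat addn1 /=; apply: leq_trans szh; rewrite addnS ltnS leq_addr.
have b3 : normc (E g3) <= (size H)%:R * (2 * (K + 2)).
  by apply: IH => //; rewrite size_cat addn1.
have eh X : eval_word X h *m eval_letter X l = eval_word X (h ++ [:: l]) by
  rewrite eval_word_cat /= mulmx1.
have -> : E (fun X => ((if l.1 then \tr (eval_word X h *m Q) *
      \tr (Y *m eval_letter X x *m Q *m (eval_letter X l *m eval_word X H)) -
      \tr (eval_word X h *m eval_letter X l *m Q) * \tr (Y *m eval_letter X x
        *m Q *m eval_word X H) else 0)
    + contraction Q X (Y *m eval_letter X x) (eval_word X h *m eval_letter X l)
      H) * F X) =
  (if l.1 then E g1 - E g2 else 0) + E g3.
  case: (l.1).
    have oZ2 := observableZ (-1) o2.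
    rewrite -[- E g2]mulN1r -(meanZ hE _ o2) -(meanD hE o1 oZ2).
    rewrite -(meanD hE (observableD o1 oZ2) o3).
    congr E; apply/funext => X; rewrite /g1 /g2 /g3 /D1 /D2 eh /=.
    rewrite [eval_letter X (_, _)]/= !mulmxA.
    by rewrite mulrDl mulrBl mulN1r.
  rewrite add0r; congr E; apply/funext => X.
  by rewrite /g3 add0r eh.
rewrite -natr1 mulrDl mul1r [leRHS]addrC.
apply: le_trans (le_normcD _ _) _; apply: lerD => //.
case: (l.1); last by rewrite normc0 mulr_ge0 // addr_ge0.
have h' := le_normcD (E g1) (- E g2); rewrite normcN in h'.
by rewrite mulr_natl mulr2n; exact: le_trans h' (lerD b1 b2).
Qed.

Lemma normc_mean3 f1 f2 f3 (c1 c2 c3 : R) t (a : C) :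
  a * t = E f1 + E f2 + E f3 \/ a * t = E f1 - E f2 - E f3 ->
  normc (E f1) <= c1 -> normc (E f2) <= c2 -> normc (E f3) <= c3 ->
  normc a * normc t <= c1 + c2 + c3.
Proof.
move=> at_ h1 h2 h3; rewrite -normcM.
have := lerD (lerD h1 h2) h3; apply: le_trans.
case: at_ => ->; apply: le_trans (le_normcD _ _) _; rewrite ?normcN lerD2r.
  exact: le_normcD.
by apply: le_trans (le_normcD _ _) _; rewrite normcN.
Qed.

(** Exactly one of x and y is conjugated.  Its derivative gives, on the side of the
    matrix unit, the trace n - 1 of Q, and on the other side the trace of Q c
    with c traceless, which stays bounded. *)
Lemma cut_bound x y H : admissible [:: x, y & H] -> ((size H).+1 <= m)%N -> 0 <= K ->
  (n%:R - 1) * normc (E (fun X =>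
    \tr (Y *m eval_letter X x *m Q *m eval_word X (y :: H)) * F X)) <=
  2 + m%:R * (2 * (K + 2)) + 2 * b0.
Proof.
move=> aw sH K0; have [ay [tx bx xy]] := admissible_cons aw.
have [aH [ty by_ _]] := admissible_cons ay.
have [_ _ cy] := ay; have [_ _ cH] := aH.
have oev := mx_observable_eval_word v; have oY := mx_observable_cst v Y.
have oQ := mx_observable_cst v Q; have oe := mx_observable_eval_letter v.
have sF1 := smooth_obs sF; have sF2 := smooth_grad_obs sF.
have oT (f g : MX -> MX) : mx_observable v f -> mx_observable v g ->
    observable v (fun X => \tr (f X *m g X)).
  by move=> of_ og; exact: (observable_tr (mx_observableM of_ og)).
pose t X := \tr (Y *m eval_letter X x *m Q *m eval_word X (y :: H)) * F X.
pose s2 X := contraction Q X (Y *m eval_letter X x) (eval_word X [:: y]) H * F X.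
pose s3 X := \tr (Y *m eval_letter X x *m (Q *m gF X *m Q) *m eval_word X (y :: H)).
have oYx := mx_observableM oY (oe x).
have ot : observable v t by exact: (observableM (oT _ _ (mx_observableM oYx oQ)
  (oev _)) sF1).
have os2 : observable v s2.
  by apply: (observableM _ sF1); exact: observable_contraction.
have os3 : observable v s3.
  by apply: oT => //; apply: (mx_observableM oYx);
    exact: (mx_observableM (mx_observableM oQ sF2) oQ).
have bs2 : normc (E s2) <= m%:R * (2 * (K + 2)).
  apply: le_trans (contraction_bound bx (h := [:: y]) _ ay _ K0) _ => //.
  apply: ler_wpM2r; first by rewrite mulr_ge0 // addr_ge0.
  by rewrite ler_nat ltnW.
have [Y1 Y2] := hY.
have bs3 : normc (E s3) <= 2 * b0.
  apply: (mean_bound hE os3) => X GX; rewrite /s3 -!mulmxA; apply: Y2.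
  have hx := opbnd_eval_letter GX bx; have hy := opbnd_eval_word GX cy.
  have hg := smooth_grad_bound sF GX.
  have h2 := opbndM b0_ge0 hg (opbnd_complM hy).
  have := opbndM ler01 hx (opbnd_complM h2).
  by rewrite mul1r mulr1.
have nn : normc (n%:R - 1 : C) = n%:R - 1.
  rewrite -[1]/(1%:R) -natrB ?(ltnW n_gt1) // normc_nat natrB //.
  exact: ltnW n_gt1.
rewrite -[X in X * _]nn.
have LE := loop_equation v1 hE Y x (y :: H) sF.
case xb : (x.1) LE xy => LE xy.
- have yb : y.1 = false by move: xy; case: (y.1).
  pose s1 X := \tr (Q *m eval_letter X x) * \tr (Y *m Q *m eval_word X (y :: H)) * F X.
  have os1 : observable v s1.
    exact: (observableM (observableM (oT _ _ oQ (oe x)) (oT _ _ (mx_observableM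
      oY oQ) (oev _))) sF1).
  have bs1 : normc (E s1) <= 2.
    rewrite -[leRHS]mulr1; apply: (mean_bound hE os1) => X GX.
    rewrite /s1 (normcM _ (F X)) (normcM (\tr _)) -[leRHS]mulr1.
    apply: ler_pM; rewrite ?mulr_ge0 ?normc_ge0 //; last exact: (smooth_bound sF).
    rewrite -[leRHS]mulr1; apply: ler_pM; rewrite ?normc_ge0 //.
      exact: tr_compl_traceless.
    by rewrite -mulmxA; apply: Y2; apply: opbnd_complM; exact: (opbnd_eval_word GX cy).
  refine (normc_mean3 (or_introl _) bs1 bs2 bs3).
  have oat := observableZ (- (n%:R - 1)) ot.
  have o12 := observableD os1 os2; have o123 := observableD o12 os3.
  have LE' : E s1 + E s2 + E s3 + - (n%:R - 1) * E t = 0.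
    rewrite -(meanD hE os1 os2) -(meanD hE o12 os3) -(meanZ hE _ ot).
    rewrite -(meanD hE o123 oat) -[RHS]LE; congr E; apply/funext => X.
    rewrite /s1 /s2 /s3 /t /= yb add0r mul1mx mulmx1.
    by ring.
  by apply/eqP; rewrite -subr_eq0 -oppr_eq0 -[X in _ == X]LE'; apply/eqP; ring.
- have yb : y.1 = true by move: xy; case: (y.1).
  pose s1 X := \tr (eval_letter X y *m Q) * \tr (Y *m eval_letter X x *m Q *m
    eval_word X H) * F X.
  have os1 : observable v s1.
    exact: (observableM (observableM (oT _ _ (oe y) oQ) (oT _ _ (mx_observableM
      oYx oQ) (oev _))) sF1).
  have bs1 : normc (E s1) <= 2.
    rewrite -[leRHS]mulr1; apply: (mean_bound hE os1) => X GX.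
    rewrite /s1 (normcM _ (F X)) (normcM (\tr _)) -[leRHS]mulr1.
    apply: ler_pM; rewrite ?mulr_ge0 ?normc_ge0 //; last exact: (smooth_bound sF).
    rewrite -[leRHS]mulr1; apply: ler_pM; rewrite ?normc_ge0 //.
      by rewrite mxtrace_mulC; exact: tr_compl_traceless.
    rewrite -!mulmxA; apply: Y2.
    have := opbndM ler01 (opbnd_eval_letter GX bx) (opbnd_complM
      (opbnd_eval_word GX cH)).
    by rewrite mul1r.
  refine (normc_mean3 (or_intror _) bs1 bs2 bs3).
  have oat := observableZ (n%:R - 1) ot.
  have os1N := observableZ (-1) os1.
  have o12 := observableD os1N os2; have o123 := observableD o12 os3.
  have LE' : -1 * E s1 + E s2 + E s3 + (n%:R - 1) * E t = 0.
    rewrite -(meanZ hE _ os1) -(meanD hE os1N os2) -(meanD hE o12 os3) -(meanZ hE _ ot).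
    rewrite -(meanD hE o123 oat) -[RHS]LE; congr E; apply/funext => X.
    rewrite /s1 /s2 /s3 /t /= yb add0r !mul1mx mulmx1 tr_compl //.
    by ring.
  by apply/eqP; rewrite -subr_eq0 -[X in _ == X]LE'; apply/eqP; ring.
Qed.


End Induction.
End Cut.

(** * Asymptotics of alternating words *)

Section Asymptotics.
Variable R : realType.
Local Notation C := R[i].

Definition tracial_bound (m : nat) := forall b : R, exists2 K : R, 0 <= K &
  forall n (v : 'cV[C]_n) (E : ('M[C]_n -> C) -> C),
    l2norm v = 1 -> (1 < n)%N -> invariant_mean v E -> tracial_bound_for v E m b K.

Lemma cut_small m : tracial_bound m -> forall b : R, 0 <= b ->
  exists2 K : R, 0 <= K &
  forall n (v : 'cV[C]_n) (E : ('M[C]_n -> C) -> C),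
    l2norm v = 1 -> (1 < n)%N -> invariant_mean v E ->
  forall Y x y H F gF b0, trace_contraction Y ->
    admissible [:: x, y & H] -> ((size H).+1 <= m)%N ->
    smooth v F gF b0 -> 0 <= b0 <= b ->
    normc (E (fun X => \tr (Y *m eval_letter X x *m (1%:M - v *m v^t*) *m
      eval_word X (y :: H)) * F X))
      <= K / n%:R.
Proof.
move=> tb b b_ge0; have [K K0 hK] := tb (2 * (m + 3)%:R + b).
pose B := 2 + m%:R * (2 * (K + 2)) + 2 * b.
have B0 : 0 <= B by rewrite !addr_ge0 ?mulr_ge0 ?addr_ge0.
exists (2 * B) => [|n v E v1 n1 hE Y x y H F gF b0 hY aw sH sF /andP[b00 b0b]].
  by rewrite mulr_ge0.
have n0 : 0 < n%:R :> R by rewrite ltr0n ltnW.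
have b0_le : 2 * (m + 3)%:R + b0 <= 2 * (m + 3)%:R + b by rewrite lerD2l.
have := cut_bound v1 n1 hE (hK n v E v1 n1 hE) sF b00 b0_le hY aw sH K0.
set z := normc _ => hz.
have z0 : 0 <= z by exact: normc_ge0.
have hzB : (n%:R - 1) * z <= B.
  by apply: le_trans hz _; rewrite /B lerD2l ler_pM2l.
rewrite ler_pdivlMr //.
have n2 : (2 : R) <= n%:R by rewrite ler_nat.
have : 0 <= (n%:R - 2) * z by rewrite mulr_ge0 // subr_ge0.
(* 1 / (n - 1) <= 2 / n because n >= 2 *)
move: hzB; rewrite !mulrBl mul1r; move: (n%:R : R) => k; lra.
Qed.

(** Insert 1 = Q + p after the first letter: the Q part is small by [cut_small],
    and the p part is 1/n times a vector state. *)
Lemma tracial_bound_all m : tracial_bound m.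
Proof.
elim: m => [|m IH] b.
  exists 0 => // n v E v1 n1 hE w _ sw.
  by move: sw; rewrite leqn0 lt0n => /andP[/negPf->].
have b0 : 0 <= `|b| by [].
have [K K0 hK] := cut_small IH b0.
exists (K + 2) => [|n v E v1 n1 hE w aw sw F gF b' sF /andP[b'0 b'b]].
  by rewrite addr_ge0.
have n0 : 0 < n%:R :> R by rewrite ltr0n ltnW.
have sF1 := smooth_obs sF.
have hY := trace_contraction_normalized R (ltnW n1).
case: w aw sw => [|x [|y H]] aw sw //.
  have [_ [tx bx _]] := admissible_cons aw.
  apply: le_trans (_ : 2 * 0 <= _); last by rewrite mulr0 divr_ge0 ?addr_ge0 // ltW.
  apply: (mean_bound hE) => [|X GX].
    apply: observableM => //; apply: observableZ; apply: observable_tr.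
    exact: mx_observable_eval_word.
  by rewrite /= mulmx1 (tr_eval_letter _ GX) tx mulr0 mul0r normc0.
have [ay [tx bx xy]] := admissible_cons aw.
have [_ _ cy] := ay.
pose D X := eval_word X (y :: H).
pose Y := (n%:R^-1)%:M : 'M[C]_n.
pose f1 X := \tr (Y *m eval_letter X x *m (1%:M - v *m v^t*) *m D X) * F X.
pose f2 X := \tr (Y *m eval_letter X x *m (v *m v^t*) *m D X) * F X.
have oYx : mx_observable v (fun X => Y *m eval_letter X x).
  by apply: mx_observableM; [exact: mx_observable_cst|exact: mx_observable_eval_letter].
have of_ M : observable v (fun X => \tr (Y *m eval_letter X x *m M *m D X) * F X).
  apply: observableM => //; apply: observable_tr; apply: mx_observableM.
    by apply: mx_observableM => //; exact: mx_observable_cst.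
  exact: mx_observable_eval_word.
have -> : E (fun X => n%:R^-1 * \tr (eval_word X [:: x, y & H]) * F X) = E f1 + E f2.
  rewrite -(meanD hE (of_ _) (of_ _)); congr E; apply/funext => X.
  rewrite /f1 /f2 -mulrDl -linearD -mulmxDl -mulmxDr subrK mulmx1.
  by rewrite /Y -mulmxA mul_scalar_mx linearZ.
rewrite mulrDl; apply: le_trans (le_normcD _ _) _; apply: lerD.
  apply: (hK n v E v1 n1 hE Y x y H F gF b') => //.
  by rewrite b'0 /=; apply: le_trans (ler_norm _).
apply: (mean_bound hE (of_ _)) => X GX.
rewrite normcM -[leRHS]mulr1; apply: ler_pM; rewrite ?normc_ge0 //; last exact:
  (smooth_bound sF).
rewrite /Y mul_scalar_mx -!scalemxAl linearZ /= normcM normcV normc_nat.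
rewrite -[leRHS]mulr1 ler_wpM2l ?invr_ge0 //.
have -> : \tr (eval_letter X x *m (v *m v^t*) *m D X) =
    \tr (v *m v^t* *m (D X *m eval_letter X x)).
  by move: (v *m v^t*) => q; rewrite -mulmxA mxtrace_mulC -mulmxA.
have [_ h] := trace_contraction_vector v1; apply: h.
have := opbndM ler01 (opbnd_eval_word GX cy) (opbnd_eval_letter GX bx).
by rewrite mulr1.
Qed.

(** Both U and U* fix v. *)
Lemma vector_state_eval_letter n (v : 'cV[C]_n) X l : stab_unitary v X ->
  \tr (v *m v^t* *m eval_letter X l) = \tr (v *m v^t* *m l.2).
Proof.
move=> [/unitarymxP XU Xv]; rewrite /eval_letter; case: (l.1) => //.
have Xsv : X^t* *m v = v by rewrite -{1}Xv mulmxA (mulmx1C XU) mul1mx.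
have vX : v^t* *m X = v^t*.
  by rewrite -[in RHS]Xsv trmx_mul map_mxM trmxCK.
rewrite -!mulmxA mxtrace_mulC [RHS]mxtrace_mulC -!mulmxA Xsv.
by rewrite (mulmxA (v^t*) X) vX.
Qed.

Lemma proj_sandwich n (v : 'cV[C]_n) M :
  v *m v^t* *m M *m (v *m v^t*) = \tr (v *m v^t* *m M) *: (v *m v^t*).
Proof.
rewrite vector_state_trE.
have -> : v *m v^t* *m M *m (v *m v^t*) = v *m (v^t* *m (M *m v)) *m v^t*.
  by rewrite !mulmxA.
by rewrite [X in v *m X *m _]mx11_scalar mul_mx_scalar scalemxAl.
Qed.

(** Insert 1 = Q + p after the first letter: the Q part is small by [cut_small],
    and the p part factorizes by [proj_sandwich]. *)
Lemma vector_bound_all m : exists2 K : R, 0 <= K &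
  forall n (v : 'cV[C]_n) (E : ('M[C]_n -> C) -> C),
    l2norm v = 1 -> (1 < n)%N -> invariant_mean v E ->
  forall w, admissible w -> size w = m ->
    normc (E (fun X => \tr (v *m v^t* *m eval_word X w)) -
           \prod_(l <- w) \tr (v *m v^t* *m l.2)) <= K / n%:R.
Proof.
elim: m => [|m [K K0 hK]].
  exists 0 => // n v E v1 n1 hE w aw /size0nil ->.
  rewrite big_nil /= (mean_cst hE) mulmx1 mxtrace_mulC (unit_dot v1) mxtrace1.
  by rewrite subrr normc0 mul0r.
have [L L0 hL] := cut_small (@tracial_bound_all m) (lexx 0).
exists (L + K) => [|n v E v1 n1 hE w aw]; first by rewrite addr_ge0.
have n0 : 0 < n%:R :> R by rewrite ltr0n ltnW.
set p := v *m v^t*.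
have hp := trace_contraction_vector v1.
case: w aw => [|x [|y H]] aw //.
  move=> [m0].
  have -> : E (fun X => \tr (p *m eval_word X [:: x])) = \tr (p *m x.2).
    rewrite -(mean_cst hE (\tr (p *m x.2))); apply: (mean_eq hE).
    - apply: observable_tr; apply: mx_observableM; first exact: mx_observable_cst.
      exact: mx_observable_eval_word.
    - exact: observable_cst.
    - by move=> X GX /=; rewrite mulmx1 vector_state_eval_letter.
  by rewrite big_seq1 subrr normc0 divr_ge0 ?addr_ge0 // ltW.
move=> [sm]; have [ay [tx bx xy]] := admissible_cons aw.
have [_ _ cy] := ay.
pose D X := eval_word X (y :: H).
pose f1 X := \tr (p *m eval_letter X x *m (1%:M - p) *m D X) * 1.
pose f2 X := \tr (p *m D X).
have oD : mx_observable v D by exact: mx_observable_eval_word.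
have oc M := mx_observable_cst v M.
have of1 : observable v f1.
  apply: observableM; last exact: observable_cst.
  apply: observable_tr; apply: mx_observableM => //; apply: mx_observableM => //.
  by apply: mx_observableM => //; exact: mx_observable_eval_letter.
have of2 : observable v f2 by apply: observable_tr; exact: mx_observableM.
have -> : E (fun X => \tr (p *m eval_word X [:: x, y & H])) =
    E f1 + \tr (p *m x.2) * E f2.
  rewrite -(meanZ hE _ of2) -(meanD hE of1); last exact: observableZ.
  apply: (mean_eq hE).
  - by apply: observable_tr; apply: mx_observableM => //; exact:
    mx_observable_eval_word.
  - by apply: observableD => //; exact: observableZ.
  move=> X GX; rewrite /f1 /f2 mulr1 -(vector_state_eval_letter x GX).
  have -> : \tr (p *m eval_letter X x) * \tr (p *m D X) = \tr (p *m eval_letter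
    X x *m p *m D X).
    by rewrite proj_sandwich -scalemxAl linearZ.
  by rewrite -linearD -mulmxDl -mulmxDr subrK mulmx1 mulmxA.
rewrite big_cons; move: (\prod_(l <- _ :: _) _) (hK n v E v1 n1 hE _ ay sm) => q hq.
have -> : E f1 + \tr (p *m x.2) * E f2 - \tr (p *m x.2) * q =
  E f1 + \tr (p *m x.2) * (E f2 - q) by ring.
rewrite mulrDl; apply: le_trans (le_normcD _ _) _; apply: lerD.
  apply: (hL n v E v1 n1 hE p x y H _ _ _ hp aw _ (smooth_1 v)); last by rewrite !lexx.
  by rewrite -sm.
rewrite normcM -[leRHS]mul1r; apply: ler_pM; rewrite ?normc_ge0 //.
by have [_ h] := hp; exact: h.
Qed.

End Asymptotics.

(** * Reduction of polynomials to alternating products *)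

Section NcMorphisms.
Context {F : numClosedFieldType} {K : choiceType}.
Implicit Types (a c : ncpoly F K) (b : bool).

Lemma ncemb_mono b (w : seq K) :
  ncemb b (ncmono w) = ncmono (map (letter b) w) :> ncpoly F (K + K)%type.
Proof. exact: nclift_mono. Qed.

Lemma ncemb1 b : ncemb b 1 = 1 :> ncpoly F (K + K)%type.
Proof. by rewrite -ncmono1 ncemb_mono ncmono1. Qed.

Lemma ncembM b a c : ncemb b (a * c) = ncemb b a * ncemb b c.
Proof.
move: a; apply: nclin_ext => [k p q|k p q|u].
- by rewrite mulrDl -scalerAl linearP.
- by rewrite linearP mulrDl -scalerAl.
move: c; apply: nclin_ext => [k p q|k p q|w].
- by rewrite mulrDr nc_scaleAr linearP.
- by rewrite linearP mulrDr nc_scaleAr.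
by rewrite ncmonoM !ncemb_mono ncmonoM map_cat.
Qed.

Lemma nceval_mono (I : choiceType) n (A : I -> 'M[F]_n) w :
  nceval A (ncmono w) = \prod_(k <- w) A k.
Proof. exact: nclift_mono. Qed.

Lemma ncevalM (I : choiceType) n (A : I -> 'M[F]_n) (P P' : ncpoly F I) :
  nceval A (P * P') = nceval A P *m nceval A P'.
Proof.
move: P; apply: nclin_ext => [k p q|k p q|u].
- by rewrite mulrDl -scalerAl linearP.
- by rewrite linearP mulmxDl -scalemxAl.
move: P'; apply: nclin_ext => [k p q|k p q|w].
- by rewrite mulrDr nc_scaleAr linearP.
- by rewrite linearP mulmxDr -scalemxAr.
by rewrite ncmonoM !nceval_mono big_cat.
Qed.

Lemma ncprod_cat (s1 s2 : seq (bool * ncpoly F K)) :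
  ncprod (s1 ++ s2) = ncprod s1 * ncprod s2.
Proof. by rewrite /ncprod big_cat. Qed.

Lemma ncprod_cons b a (s : seq (bool * ncpoly F K)) :
  ncprod ((b, a) :: s) = ncemb b a * ncprod s.
Proof. by rewrite /ncprod big_cons. Qed.

Lemma ncmono_ncprod (w : seq (K + K)%type) :
  ncmono w = ncprod [seq match x with
    | inl k => (false, ncmono [:: k]) | inr k => (true, ncmono [:: k]) end | x <- w]
  :> ncpoly F (K + K)%type.
Proof.
elim: w => [|x w IH]; first by rewrite /= /ncprod big_nil ncmono1.
by case: x => k; rewrite map_cons ncprod_cons -IH ncemb_mono ncmonoM.
Qed.

End NcMorphisms.

Lemma unsorted_split (T : Type) (e : rel T) (s : seq T) : ~~ sorted e s ->
  exists s1 p q s2, s = s1 ++ [:: p, q & s2] /\ ~~ e p q.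
Proof.
elim: s => [|p [|q s] IH] //; rewrite [sorted e _]/= negb_and.
have [epq /= h|epq _] := boolP (e p q); last by exists [::], p, q, s.
have [s1 [p' [q' [s2 [-> h']]]]] := IH h.
by exists (p :: s1), p', q', s2.
Qed.

Section Reduction.
Variables (R : realType) (K : choiceType) (J : Type).
Local Notation C := R[i].
Local Notation pol := (ncpoly C K).
Variables (err : J -> ncpoly C (K + K)%type -> C) (eps : J -> R).
Variables (bd : J -> bool -> pol -> R -> Prop) (psi : J -> bool -> pol -> C).
Hypothesis eps_ge0 : forall j, 0 <= eps j.
Hypothesis err_scalar : forall j, scalar (err j).
Hypothesis err_emb : forall j b a, err j (ncemb b a) = 0.
Hypothesis bdM : forall j b a a' c, 0 <= c -> bd j b a c -> bd j b a' c ->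
  bd j b (a * a') (c * c).
Hypothesis bd_center : forall j b a c, bd j b a c ->
  bd j b (a - psi j b a *: 1) (c + c).
Hypothesis bd_le : forall j b a c c', c <= c' -> bd j b a c -> bd j b a c'.
Hypothesis bd_psi : forall j b a c, bd j b a c -> normc (psi j b a) <= c.
Hypothesis psi_center : forall j b a, psi j b (a - psi j b a *: 1) = 0.
Implicit Types s : seq (bool * pol).

Let bounded j s (c : R) := forall p, p \in s -> bd j p.1 p.2 c.

Hypothesis err_small : forall m c, 1 <= c -> exists2 L : R, 0 <= L & forall j s,
  Defs.alternating s -> (forall p, p \in s -> psi j p.1 p.2 = 0) -> bounded j s c ->
  size s = m -> normc (err j (ncprod s)) <= L * eps j.

Let errD j P P' : err j (P + P') = err j P + err j P'.
Proof. by have := err_scalar j 1 P P'; rewrite scale1r mul1r. Qed.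

Let err0 j : err j 0 = 0.
Proof. by have := errD j 0 0; rewrite addr0 -[X in X = _]addr0 => /addrI <-. Qed.

Let errZ j z P : err j (z *: P) = z * err j P.
Proof. by have := err_scalar j z P 0; rewrite !addr0 err0 addr0. Qed.

Let bounded_cat j s1 s2 c : bounded j (s1 ++ s2) c <-> bounded j s1 c /\ bounded j s2 c.
Proof.
split=> [h|[h1 h2] p]; first by split=> p ps; apply: h; rewrite mem_cat ps ?orbT.
by rewrite mem_cat => /orP[/h1|/h2].
Qed.

Let bounded_cons j p s c : bounded j (p :: s) c <-> bd j p.1 p.2 c /\ bounded j s c.
Proof.
split=> [h|[h1 h2] q].
  by split=> [|q qs]; apply: h; rewrite inE ?eqxx ?qs ?orbT.
by rewrite inE => /orP[/eqP->//|/h2].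
Qed.

Let bounded_le j s c c' : c <= c' -> bounded j s c -> bounded j s c'.
Proof. by move=> cc h p /h; exact: bd_le. Qed.

Let alternatingE s : Defs.alternating s = sorted (fun x y : bool => x != y) (map fst s).
Proof. by rewrite /Defs.alternating sorted_map. Qed.

(** Neighbours from the same factor are merged, which shortens the product.  If
    there are none, the letters are centered one at a time from the left, and
    each scalar part that is removed leaves a shorter product.  Bounds are
    squared or doubled on the way, whence the assumption 1 <= c. *)
Lemma err_ncprod m c : 1 <= c -> exists2 L : R, 0 <= L &
  forall j s, (size s <= m)%N -> bounded j s c ->
    normc (err j (ncprod s)) <= L * eps j.
Proof.
elim: m c => [|m IH] c c1.
  exists 0 => // j s; rewrite leqn0 => /nilP -> _.
  by rewrite /ncprod big_nil -(ncemb1 false) err_emb normc0 mul0r.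
have centering k : forall c, 1 <= c -> exists2 L : R, 0 <= L & forall j s1 s2,
    size s2 = k -> size (s1 ++ s2) = m.+1 -> Defs.alternating (s1 ++ s2) ->
    (forall p, p \in s1 -> psi j p.1 p.2 = 0) -> bounded j (s1 ++ s2) c ->
    normc (err j (ncprod (s1 ++ s2))) <= L * eps j.
  elim: k => [|k IHk] {}c {}c1.
    have [L L0 hL] := err_small m.+1 c1.
    exists L => // j s1 s2 /size0nil -> sz al ce bo.
    by rewrite !cats0 in sz al bo *; exact: hL.
  have cc : 1 <= c + c by rewrite (le_trans c1) // lerDl (le_trans ler01).
  have [L1 L10 hL1] := IHk (c + c) cc.
  have [L2 L20 hL2] := IH c c1.
  have c0 : 0 <= c by exact: le_trans c1.
  exists (L1 + c * L2) => [|j s1 [//|[b a] s2] [sz2] sz al ce bo].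
    by rewrite addr_ge0 // mulr_ge0.
  have [bo1 /bounded_cons[/= boa bo2]] := (bounded_cat j s1 _ c).1 bo.
  set a' := a - psi j b a *: 1.
  have ea : a = a' + psi j b a *: 1 by rewrite /a' subrK.
  have -> : ncprod (s1 ++ (b, a) :: s2) =
      ncprod ((s1 ++ [:: (b, a')]) ++ s2) + psi j b a *: ncprod (s1 ++ s2).
    rewrite -catA /= !ncprod_cat !ncprod_cons {1}ea linearD linearZ /= ncemb1.
    by rewrite mulrDl mulrDr -scalerAl mul1r nc_scaleAr.
  rewrite errD errZ mulrDl; apply: le_trans (le_normcD _ _) _; apply: lerD.
    apply: hL1 => //.
    - by move: sz; rewrite -catA !size_cat.
    - by move: al; rewrite !alternatingE -catA /= !map_cat.
    - by move=> p; rewrite mem_cat inE => /orP[/ce//|/eqP->]; exact: psi_center.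
    - apply/bounded_cat; split; last by apply: bounded_le bo2; rewrite lerDl.
      apply/bounded_cat; split; first by apply: bounded_le bo1; rewrite lerDl.
      by apply/bounded_cons; split => //; exact: bd_center.
  rewrite normcM -mulrA; apply: ler_pM; rewrite ?normc_ge0 //; first exact: bd_psi.
  apply: hL2.
    by move: sz; rewrite !size_cat /= addnS => -[->].
  by apply/bounded_cat.
have [L1 L10 hL1] := centering m.+1 c c1.
have cc : 1 <= c * c by rewrite -[1]mulr1 ler_pM.
have [L2 L20 hL2] := IH (c * c) cc.
have c0 : 0 <= c by exact: le_trans c1.
exists (L1 + L2) => [|j s sz bo]; first by rewrite addr_ge0.
have le1 : L1 * eps j <= (L1 + L2) * eps j by rewrite ler_wpM2r // lerDl.
have le2 : L2 * eps j <= (L1 + L2) * eps j by rewrite ler_wpM2r // lerDr.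
have cle : c <= c * c by rewrite -[X in X <= _]mulr1 ler_wpM2l.
move: sz; rewrite leq_eqVlt => /orP[/eqP sz|]; last first.
  rewrite ltnS => sz; apply: le_trans le2; apply: hL2 => //.
  exact: bounded_le bo.
have [al|/unsorted_split[s1 [[b a] [[b' a'] [s2 [es /negPn/eqP /= bb]]]]]] :=
    boolP (Defs.alternating s).
  by apply: le_trans le1; exact: (hL1 j [::] s).
move: sz bo; rewrite {}es -{b'}bb => sz /bounded_cat[bo1 /bounded_cons[/= ba]].
move=> /bounded_cons[/= ba' bo2]; apply: le_trans le2.
have -> : ncprod (s1 ++ [:: (b, a), (b, a') & s2]) = ncprod (s1 ++ (b, a * a') :: s2).
  rewrite (ncprod_cat s1 [:: (b, a), (b, a') & s2]) (ncprod_cat s1 (_ :: s2)).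
  rewrite (ncprod_cons b a) (ncprod_cons b a') (ncprod_cons b (a * a')) ncembM.
  by rewrite (mulrA (ncemb b a)).
apply: hL2; first by move: sz; rewrite !size_cat /= !addnS => -[->].
apply/bounded_cat; split; first exact: bounded_le bo1.
apply/bounded_cons; split; first exact: bdM.
exact: bounded_le bo2.
Qed.

Variable r : R.
Hypothesis r1 : 1 <= r.
Hypothesis bd_letter : forall j b k, bd j b (ncmono [:: k]) r.

Lemma err_bound P : exists2 L : R, 0 <= L & forall j, normc (err j P) <= L * eps j.
Proof.
have mono w : exists2 L : R, 0 <= L & forall j, normc (err j (ncmono w)) <= L * eps j.
  have [L L0 hL] := err_ncprod (size w) r1.
  exists L => // j; rewrite ncmono_ncprod; apply: hL; first by rewrite size_map.
  by move=> p /mapP[[k|k] _ ->]; exact: bd_letter.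
rewrite (ncpolyE P); elim: (enum_fset (msupp P)) => [|w s [L L0 hL]].
  by exists 0 => // j; rewrite big_nil err0 normc0 mul0r.
have [L' L'0 hL'] := mono w.
exists (normc P@_w * L' + L) => [|j].
  by rewrite addr_ge0 // mulr_ge0 // normc_ge0.
rewrite big_cons errD errZ mulrDl; apply: le_trans (le_normcD _ _) _; apply: lerD => //.
by rewrite normcM -mulrA ler_wpM2l ?normc_ge0.
Qed.

End Reduction.

(** * The error functionals *)

Section Instantiation.
Variables (R : realType) (K : choiceType) (r : R).
Local Notation C := R[i].
Local Notation pol := (ncpoly C K).
Variables (v : forall N : nat, 'cV[C]_N.+1).
Hypothesis v_unit : forall N, l2norm (v N) = 1.
Variable E : forall N, ('M[C]_N.+1 -> C) -> C.
Hypothesis hE : forall N, invariant_mean (v N) (@E N).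

Section Evaluation.
Variables (n : nat) (A B : K -> 'M[C]_n) (u : 'cV[C]_n).
Implicit Types (X : 'M[C]_n) (a : pol) (s : seq (bool * pol)).

Definition family (b : bool) := if b then B else A.

Definition evaluate (p : bool * pol) : bool * 'M[C]_n :=
  (p.1, nceval (family p.1) p.2).

Lemma nceval_emb X b a : X \is unitarymx ->
  nceval (join_family A (conj_family X B)) (ncemb b a) =
  eval_letter X (b, nceval (family b) a).
Proof.
move=> /unitarymxP XU; have XsX := mulmx1C XU.
move: a; apply: nclin_ext => [k p q|k p q|w].
- by rewrite !linearP.
- rewrite /eval_letter /= linearP /=; case: (b) => //.
  by rewrite mulmxDr mulmxDl -scalemxAr -scalemxAl.
rewrite ncemb_mono !nceval_mono /eval_letter big_map; case: b => //=.
elim: w => [|k w IH]; first by rewrite !big_nil mulmx1 XU.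
rewrite !big_cons IH -[RHS]mulmxA /conj_family.
rewrite -[_ * _]/(X *m B k *m X^t* *m (X *m (\prod_(j <- w) B j) *m X^t*)).
rewrite -[(B k * _)]/(B k *m (\prod_(j <- w) B j)).
by rewrite !mulmxA -(mulmxA _ (X^t*) X) XsX mulmx1.
Qed.

Lemma nceval_ncprod X s : X \is unitarymx ->
  nceval (join_family A (conj_family X B)) (ncprod s) = eval_word X (map evaluate s).
Proof.
move=> XU; elim: s => [|[b a] s IH].
  by rewrite /ncprod big_nil nceval1.
by rewrite ncprod_cons ncevalM IH nceval_emb.
Qed.

Lemma mx_observable_nceval P :
  mx_observable u (fun X => nceval (join_family A (conj_family X B)) P).
Proof.
have word w : mx_observable u
    (fun X => nceval (join_family A (conj_family X B)) (ncmono w)).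
  rewrite (_ : (fun _ => _) = (fun X => eval_word X
    [seq match x with inl k => (false, A k) | inr k => (true, B k) end | x <- w])).
    exact: mx_observable_eval_word.
  apply/funext => X; rewrite nceval_mono; elim: w => [|x w IH]; first by
    rewrite big_nil.
  by rewrite big_cons IH /=; case: x.
rewrite {1}(ncpolyE P); elim: (enum_fset (msupp P)) => [|w s IH].
  rewrite (_ : (fun _ => _) = (fun=> 0)); first exact: mx_observable_cst.
  by apply/funext => X; rewrite big_nil linear0.
rewrite (_ : (fun _ => _) = (fun X => P@_w *: nceval (join_family A (conj_family X B))
   (ncmono w) + nceval (join_family A (conj_family X B))
     (\sum_(w <- s) P@_w *: ncmono w))).
  apply: mx_observableD => //; apply: mx_observableZ => //; exact: observable_cst.
by apply/funext => X; rewrite big_cons linearP.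
Qed.

Lemma eval_word_scale X (z : C) (w : seq (bool * 'M[C]_n)) :
  eval_word X [seq (l.1, z *: l.2) | l <- w] = z ^+ size w *: eval_word X w.
Proof.
elim: w => [|l w IH] /=; first by rewrite expr0 scale1r.
rewrite IH exprS /eval_letter /=; case: (l.1).
  by rewrite -[X *m (z *: _)]scalemxAr -!scalemxAl -scalemxAr scalerA.
by rewrite -scalemxAl -scalemxAr scalerA.
Qed.

End Evaluation.

(** The data over which the error is uniform.  Dimension 1 is excluded because
    Q = 0 there. *)
Record config := Config {
  index_of : nat;
  left_of : K -> 'M[C]_(index_of.+1);
  right_of : K -> 'M[C]_(index_of.+1);
  index_gt0 : (0 < index_of)%N;
  left_bound : forall k, opnorm (left_of k) <= r;
  right_bound : forall k, opnorm (right_of k) <= r }.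

Let fam j b := family (left_of j) (right_of j) b.
Let bd j b (a : pol) c := opbnd (nceval (fam j b) a) c.
Let psi j b := tracial_dist (fam j b).
Let eps j : R := (index_of j).+1%:R^-1.
Let joint j X := join_family (left_of j) (conj_family X (right_of j)).

Let eps_ge0 j : 0 <= eps j.
Proof. by rewrite invr_ge0. Qed.

Let bdM j b a a' c : 0 <= c -> bd j b a c -> bd j b a' c -> bd j b (a * a') (c * c).
Proof. by move=> c0 ha ha'; rewrite /bd ncevalM; exact: (opbndM c0 ha ha'). Qed.

Let bd_psi j b a c : bd j b a c -> normc (psi j b a) <= c.
Proof.
move=> ha; rewrite /psi /tracial_dist normcM normcV normc_nat ler_pdivrMl ?ltr0n //.
exact: normc_tr_opbnd.
Qed.

Let bd_center j b a c : bd j b a c -> bd j b (a - psi j b a *: 1) (c + c).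
Proof.
move=> ha; rewrite /bd linearB linearZ /= nceval1.
apply: opbndD => //; apply: opbndN; apply: (opbnd_le _ (opbndZ _ (@opbnd1 R _))).
by rewrite mulr1; exact: bd_psi.
Qed.

Let bd_le j b a c c' : c <= c' -> bd j b a c -> bd j b a c'.
Proof. exact: opbnd_le. Qed.

Let psi_center j b a : psi j b (a - psi j b a *: 1) = 0.
Proof.
have lin := @tracial_dist_scalar C K _ (fam j b).
rewrite -scaleNr addrC /psi lin tracial_dist1 // mulr1 addNr.
by [].
Qed.

Let bd_letter j b k : bd j b (ncmono [:: k]) (Num.max 1 r).
Proof.
rewrite /bd nceval_mono big_seq1; apply: opbnd_le (_ : r <= _) _.
  by rewrite le_max lexx orbT.
by apply: opnorm_opbnd; case: b; [exact: right_bound|exact: left_bound].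
Qed.

Let scaled j c (s : seq (bool * pol)) :=
  [seq (l.1, (c^-1)%:C *: l.2) | l <- map (evaluate (left_of j) (right_of j)) s].

Let admissible_scaled j c s : 1 <= c -> Defs.alternating s ->
  (forall p, p \in s -> psi j p.1 p.2 = 0) ->
  (forall p, p \in s -> bd j p.1 p.2 c) -> admissible (scaled j c s).
Proof.
move=> c1 al ce bo; have c0 : 0 < c by exact: lt_le_trans c1.
split.
- by move: al; rewrite /alternates /Defs.alternating !sorted_map.
- move=> l /mapP[m /mapP[p ps ->] ->] /=; rewrite linearZ /=.
  have := ce p ps; rewrite /psi /tracial_dist /fam => /eqP.
  rewrite mulf_eq0 invr_eq0 pnatr_eq0 /= => /eqP ->; by rewrite mulr0.
- move=> l /mapP[m /mapP[p ps ->] ->] /=.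
  apply: (opbnd_le _ (opbndZ _ (bo p ps))).
  by rewrite normc_real ger0_norm ?invr_ge0 ?(ltW c0) // mulVf ?gt_eqF.
Qed.

Let err_tr (j : config) (P : ncpoly C (K + K)%type) := @E (index_of j) (fun X
  => tracial_dist (@joint j X) P)
  - free_product (tracial_dist (left_of j)) (tracial_dist (right_of j)) P.

Let err_vec (j : config) (P : ncpoly C (K + K)%type) := @E (index_of j) (fun X
  => vector_dist (v (index_of j)) (@joint j X) P)
  - cfree_product (tracial_dist (left_of j)) (tracial_dist (right_of j))
      (vector_dist (v (index_of j)) (left_of j))
      (vector_dist (v (index_of j)) (right_of j)) P.

Let onf T (f : (K -> T) -> pol -> C) (A B : K -> T) b a :
  on_factors (f A) (f B) b a = f (if b then B else A) a.
Proof. by case: b. Qed.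

Let freeP j := @free_productP C K _ _
  (@tracial_dist_scalar C K _ (left_of j)) (@tracial_dist_scalar C K _ (right_of j))
  (@tracial_dist1 C K _ (left_of j) isT) (@tracial_dist1 C K _ (right_of j) isT).

Let cfreeP j := @cfree_productP C K _ _
  (@tracial_dist_scalar C K _ (left_of j)) (@tracial_dist_scalar C K _ (right_of j))
  (@tracial_dist1 C K _ (left_of j) isT) (@tracial_dist1 C K _ (right_of j) isT)
  _ _ (@vector_dist_scalar C K _ (v (index_of j)) (left_of j))
  (@vector_dist_scalar C K _ (v (index_of j)) (right_of j))
  (@vector_dist1 R K _ _ (left_of j) (v_unit (index_of j)))
  (@vector_dist1 R K _ _ (right_of j) (v_unit (index_of j))).

Let observable_tracial j P :
  observable (v (index_of j)) (fun X => tracial_dist (@joint j X) P).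
Proof. by apply: observableZ; apply: observable_tr; exact: mx_observable_nceval. Qed.

Let observable_vector j P :
  observable (v (index_of j)) (fun X => vector_dist (v (index_of j)) (@joint j X) P).
Proof.
apply: observable_tr; apply: mx_observableM; first exact: mx_observable_cst.
exact: mx_observable_nceval.
Qed.

Let err_tr_scalar j : scalar (err_tr j).
Proof.
move=> z P P'; have [lin _ _] := freeP j; rewrite /err_tr lin.
rewrite (_ : (fun _ => _) = (fun X => z * tracial_dist (@joint j X) P +
   tracial_dist (@joint j X) P')).
  rewrite (mean_lin (hE _)); [|exact: observable_tracial|exact: observable_tracial].
  by rewrite mulrBr opprD addrACA.
by apply/funext => X; rewrite tracial_dist_scalar.
Qed.

Let err_vec_scalar j : scalar (err_vec j).
Proof.
move=> z P P'; have [lin _ _] := cfreeP j; rewrite /err_vec lin.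
rewrite (_ : (fun _ => _) = (fun X => z * vector_dist (v (index_of j)) (@joint j X) P +
   vector_dist (v (index_of j)) (@joint j X) P')).
  rewrite (mean_lin (hE _)); [|exact: observable_vector|exact: observable_vector].
  by rewrite mulrBr opprD addrACA.
by apply/funext => X; rewrite vector_dist_scalar.
Qed.

Let err_tr_emb j b a : err_tr j (ncemb b a) = 0.
Proof.
have [_ ext _] := freeP j; rewrite /err_tr ext onf.
apply/eqP; rewrite subr_eq0; apply/eqP.
rewrite -[RHS](mean_cst (hE (index_of j))); apply: (mean_eq (hE _)).
- exact: observable_tracial.
- exact: observable_cst.
move=> X [XU Xv]; rewrite /tracial_dist nceval_emb //.
by rewrite (@tr_eval_letter _ _ (v (index_of j))).
Qed.

Let err_vec_emb j b a : err_vec j (ncemb b a) = 0.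
Proof.
have [_ ext _] := cfreeP j; rewrite /err_vec ext onf.
apply/eqP; rewrite subr_eq0; apply/eqP.
rewrite -[RHS](mean_cst (hE (index_of j))); apply: (mean_eq (hE _)).
- exact: observable_vector.
- exact: observable_cst.
move=> X GX; rewrite /vector_dist nceval_emb; last by case: GX.
by rewrite vector_state_eval_letter.
Qed.

Let n_gt1 j : (1 < (index_of j).+1)%N.
Proof. by rewrite ltnS; exact: index_gt0. Qed.

Let centeredE j s : (forall p, p \in s -> psi j p.1 p.2 = 0) ->
  centered (free_product (tracial_dist (left_of j)) (tracial_dist (right_of j))) s.
Proof. by move=> ce p /ce; have [_ -> _] := freeP j; rewrite onf. Qed.

Let expcC c m : 1 <= c -> ((c^-1)%:C ^+ m : C) * (c%:C ^+ m) = 1.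
Proof.
move=> c1; rewrite -exprMn -real_complexME mulVf ?expr1n //.
by rewrite gt_eqF // (lt_le_trans ltr01).
Qed.

Let normc_exp c m : 1 <= c -> normc (c%:C ^+ m : C) = c ^+ m.
Proof.
move=> c1; rewrite -rmorphXn normc_real ger0_norm // exprn_ge0 //.
exact: le_trans c1.
Qed.

Let err_tr_small m c : 1 <= c -> exists2 L : R, 0 <= L & forall j s,
  Defs.alternating s -> (forall p, p \in s -> psi j p.1 p.2 = 0) ->
  (forall p, p \in s -> bd j p.1 p.2 c) ->
  size s = m -> normc (err_tr j (ncprod s)) <= L * eps j.
Proof.
move=> c1; have [L L0 hL] := tracial_bound_all m (0 : R).
have c0 : 0 <= c by exact: le_trans c1.
exists (c ^+ m * L) => [|j s al ce bo sm]; first by rewrite mulr_ge0 ?exprn_ge0.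
have [s0|s0] := eqVneq s [::].
  rewrite s0 /ncprod big_nil -(ncemb1 false) err_tr_emb normc0.
  by rewrite mulr_ge0 // mulr_ge0 // exprn_ge0.
have [_ _ van] := freeP j.
rewrite /err_tr van // ?subr0; last exact: centeredE.
have aw := admissible_scaled c1 al ce bo.
have -> : @E (index_of j) (fun X => tracial_dist (@joint j X) (ncprod s)) =
  c%:C ^+ m * @E (index_of j) (fun X =>
    (index_of j).+1%:R^-1 * \tr (eval_word X (scaled j c s)) * 1).
  have o1 : observable (v (index_of j)) (fun X =>
    (index_of j).+1%:R^-1 * \tr (eval_word X (scaled j c s)) * 1).
    apply: observableM; last exact: observable_cst.
    by apply: observableZ; apply: observable_tr; exact: mx_observable_eval_word.
  rewrite -(meanZ (hE _) _ o1); apply: (mean_eq (hE _)).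
  - exact: observable_tracial.
  - exact: observableZ.
  move=> X [XU _]; rewrite /tracial_dist nceval_ncprod // /scaled eval_word_scale.
  rewrite size_map sm mulr1 linearZ /=; move: (\tr _) => t.
  by rewrite -[in LHS](mul1r t) -(expcC m c1); ring.
rewrite normcM normc_exp // -mulrA ler_wpM2l ?exprn_ge0 //.
apply: (hL _ _ _ (v_unit _) (n_gt1 j) (hE _) _ aw _ _ _ _ (smooth_1 _)).
  by rewrite !size_map sm leqnn -sm lt0n size_eq0 s0.
by rewrite !lexx.
Qed.

Let err_vec_small m c : 1 <= c -> exists2 L : R, 0 <= L & forall j s,
  Defs.alternating s -> (forall p, p \in s -> psi j p.1 p.2 = 0) ->
  (forall p, p \in s -> bd j p.1 p.2 c) ->
  size s = m -> normc (err_vec j (ncprod s)) <= L * eps j.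
Proof.
move=> c1; have [L L0 hL] := vector_bound_all R m.
have c0 : 0 <= c by exact: le_trans c1.
exists (c ^+ m * L) => [|j s al ce bo sm]; first by rewrite mulr_ge0 ?exprn_ge0.
have [s0|s0] := eqVneq s [::].
  rewrite s0 /ncprod big_nil -(ncemb1 false) err_vec_emb normc0.
  by rewrite mulr_ge0 // mulr_ge0 // exprn_ge0.
have [_ ext fact] := cfreeP j.
rewrite /err_vec fact //; last exact: centeredE.
have aw := admissible_scaled c1 al ce bo.
set p := v (index_of j) *m (v (index_of j))^t*.
have -> : @E (index_of j) (fun X =>
    vector_dist (v (index_of j)) (@joint j X) (ncprod s)) =
  c%:C ^+ m * @E (index_of j) (fun X => \tr (p *m eval_word X (scaled j c s))).
  have o1 : observable (v (index_of j)) (fun X => \tr (p *m eval_word X (scaled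
    j c s))).
    apply: observable_tr; apply: mx_observableM; first exact: mx_observable_cst.
    exact: mx_observable_eval_word.
  rewrite -(meanZ (hE _) _ o1); apply: (mean_eq (hE _)).
  - exact: observable_vector.
  - exact: observableZ.
  move=> X [XU _]; rewrite /vector_dist nceval_ncprod // /scaled eval_word_scale.
  by rewrite size_map sm -scalemxAr linearZ /= mulrA (mulrC (c%:C ^+ m)) expcC // mul1r.
have -> : \prod_(q <- s) cfree_product (tracial_dist (left_of j))
     (tracial_dist (right_of j)) (vector_dist (v (index_of j)) (left_of j))
     (vector_dist (v (index_of j)) (right_of j)) (ncemb q.1 q.2) =
   c%:C ^+ m * \prod_(l <- scaled j c s) \tr (p *m l.2).
  rewrite !big_map /=.
  have key (f : bool * pol -> C) :
      \prod_(q <- s) f q = c%:C ^+ m * \prod_(q <- s) ((c^-1)%:C * f q).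
    rewrite -sm; elim: (s) => [|q t IH]; first by rewrite !big_nil expr0 mul1r.
    rewrite !big_cons IH exprS; have := expcC 1 c1; rewrite !expr1 => e.
    by rewrite -[X in X * _ = _]mul1r -e; ring.
  rewrite key; congr (_ * _); apply: eq_bigr => q _.
  by rewrite ext onf -scalemxAr linearZ.
rewrite -mulrBr normcM normc_exp // -mulrA ler_wpM2l ?exprn_ge0 //.
by apply: (hL _ _ _ (v_unit _) (n_gt1 j) (hE _) _ aw); rewrite !size_map.
Qed.

Let r1 : 1 <= Num.max 1 r. Proof. by rewrite le_max lexx. Qed.

Lemma tracial_error P : uniformly_O_inv r (fun N (A B : K -> 'M[C]_N.+1) =>
  @E N (fun X => tracial_dist (join_family A (conj_family X B)) P)
    - free_product (tracial_dist A) (tracial_dist B) P).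
Proof.
have [L L0 hL] := err_bound eps_ge0 err_tr_scalar err_tr_emb bdM bd_center bd_le
  bd_psi psi_center err_tr_small r1 bd_letter P.
exists L, 1%N => A B hA hB N N1.
exact: (hL (Config N1 (hA N) (hB N))).
Qed.

Lemma vector_error P : uniformly_O_inv r (fun N (A B : K -> 'M[C]_N.+1) =>
  @E N (fun X => vector_dist (v N) (join_family A (conj_family X B)) P)
    - cfree_product (tracial_dist A) (tracial_dist B)
          (vector_dist (v N) A) (vector_dist (v N) B) P).
Proof.
have [L L0 hL] := err_bound eps_ge0 err_vec_scalar err_vec_emb bdM bd_center bd_le
  bd_psi psi_center err_vec_small r1 bd_letter P.
exists L, 1%N => A B hA hB N N1.
exact: (hL (Config N1 (hA N) (hB N))).
Qed.

End Instantiation.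

(** * Asymptotic freeness and conditional freeness *)

Theorem theorem4p1p1 (R : realType) (K : choiceType) (r : R) (r_gt0 : 0 < r)
    (v : forall N : nat, 'cV[R[i]]_N.+1)
    (v_unit : forall N, l2norm (v N) = 1)
    (d : nat -> measure_display) (T : forall N, measurableType (d N))
    (Pr : forall N, probability (T N) R)
    (U : forall N, {RV (Pr N) >-> (mxBorel R N.+1)})
    (U_haar : forall N, uniform_stab_unitary (v N) (U N)) :
  forall P : ncpoly R[i] (K + K)%type,
    uniformly_O_inv r (fun N (A B : K -> 'M[R[i]]_N.+1) =>
      cexpectation (Pr N)
        (fun t => tracial_dist (join_family A (conj_family (U N t) B)) P)
      - free_product (tracial_dist A) (tracial_dist B) P) /\
    uniformly_O_inv r (fun N (A B : K -> 'M[R[i]]_N.+1) =>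
      cexpectation (Pr N)
        (fun t => vector_dist (v N) (join_family A (conj_family (U N t) B)) P)
      - cfree_product (tracial_dist A) (tracial_dist B)
          (vector_dist (v N) A) (vector_dist (v N) B) P).
Proof.
move=> P; have hE N := haar_mean (U_haar N).
by split; [exact: (tracial_error r v_unit hE P)|exact: (vector_error r v_unit hE P)].
Qed.
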